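(* For every even integer $n\geq 4$, the 3-path-connectivity of the augmented cube $AQ_n$ is $$\pi_3(AQ_n)=\frac{3n}{2}-2 .$$
   Context: Path-connectivity. Let $G=(V,E)$ be a connected simple graph and let $D\subseteq V$ with $|D|\geq 2$. A path $P$ in $G$ is called a $D$-path if all the vertices of $D$ lie on $P$. A collection of $D$-paths $P_1,\dots,P_m$ is a set of internally disjoint $D$-paths if for all $1\leq i\neq j\leq m$ one has $V(P_i)\cap V(P_j)=D$ and $E(P_i)\cap E(P_j)=\emptyset$. Let $\pi_G(D)$ be the maximum number of internally disjoint $D$-paths in $G$. For an integer $k$ with $2\leq k\leq |V(G)|$, the $k$-path-connectivity of $G$ is $\pi_k(G)=\min\{\pi_G(D) \mid D\subseteq V(G),\ |D|=k\}$. Augmented cube. The augmented cube $AQ_n$ of dimension $n$ is a graph with vertex set $\{x_1x_2\dots x_n \mid x_i\in\{0,1\},\ 1\leq i\leq n\}$, so it has $2^n$ vertices. $AQ_1=K_2$ is the complete graph on two vertices. For $n\geq 2$, $AQ_n$ is constructed recursively from two disjoint copies $AQ_{n-1}^0$ and $AQ_{n-1}^1$ of $AQ_{n-1}$, whose vertices are prefixed by $0$ and $1$ respectively: $V(AQ_n)=V(AQ_{n-1}^0)\cup V(AQ_{n-1}^1)$, and the edges of $AQ_n$ are all edges within $AQ_{n-1}^0$ and within $AQ_{n-1}^1$, together with, for each vertex $x=0x_1x_2\dots x_{n-1}\in V(AQ_{n-1}^0)$, the hypercubic edge joining $x$ to $1x_1x_2\dots x_{n-1}$ and the complementary edge joining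 $x$ to $1\overline{x_1x_2\dots x_{n-1}}$, where $\overline{x_1x_2\dots x_{n-1}}$ denotes the bitwise complement of $x_1x_2\dots x_{n-1}$. *)

(* Defs.v *)
From mathcomp Require Import all_boot.

Set Implicit Arguments.
Unset Strict Implicit.
Unset Printing Implicit Defensive.

Section PathConnectivity.
Variables (T : finType) (e : rel T).
Implicit Types (s : seq T) (D : {set T}) (k : nat).

Definition is_path s := [&& s != [::], sorted e s & uniq s].

Definition path_vertices s : {set T} := [set x in s].

Definition path_edges s : {set {set T}} :=
  [set [set q.1; q.2] | q in zip s (behead s)].

Definition is_Dpath D s := is_path s && (D \subset path_vertices s).

(* A path visits at most #|T| vertices, so bounded sequences lose nothing.
   For #|D| >= 2 every D-path has an edge, hence the members of an internally
   disjoint collection are distinct (as subgraphs: a path and its reversal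
   cannot both occur) and the collection may be taken to be a set. *)
Definition internally_disjoint D (F : {set #|T|.-bseq T}) :=
  [forall P in F, is_Dpath D P] &&
  [forall P in F, forall Q in F, (P != Q) ==>
     (path_vertices P :&: path_vertices Q == D)
       && (path_edges P :&: path_edges Q == set0)].

Definition pi_set D : nat :=
  \max_(F : {set #|T|.-bseq T} | internally_disjoint D F) #|F|.

(* The default value of the minimum is the maximum over the same range, so it
   never affects the result when the range is nonempty, i.e. k <= #|T|. *)
Definition path_connectivity k : nat :=
  \big[minn / \max_(D : {set T} | #|D| == k) pi_set D]_(D : {set T} | #|D| == k)
     pi_set D.

Lemma path_connectivity_le D : path_connectivity #|D| <= pi_set D.
Proof.
rewrite /path_connectivity; move: (\max_(_ | _) _) (mem_index_enum D) => m.
elim: (index_enum _) => //= D' r IH; rewrite inE big_cons.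
case/predU1P=> [<-|/IH le_r]; first by rewrite eqxx geq_minl.
by case: ifP => // _; apply: leq_trans (geq_minr _ _) le_r.
Qed.

Lemma path_connectivity_attained k : k <= #|T| ->
  exists2 D : {set T}, #|D| = k & pi_set D = path_connectivity k.
Proof.
move=> lekT; pose D0 : {set T} := [set x in take k (enum T)].
have cD0 : #|D0| == k.
  rewrite cardsE (card_uniqP _) ?take_uniq ?enum_uniq // size_take_min -cardE.
  by apply/eqP/minn_idPl.
rewrite /path_connectivity.
elim/big_ind: _ => [|x y [D1 ? <-] [D2 ? <-]|D /eqP ?]; last by exists D.
  have ne : 0 < #|[pred D : {set T} | #|D| == k]| by apply/card_gt0P; exists D0.
  by have [D /eqP cD ->] := eq_bigmax_cond pi_set ne; exists D.
by case: (leqP (pi_set D1) (pi_set D2)) => _; [exists D1 | exists D2].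
Qed.

End PathConnectivity.

(* Equal first bits: an edge inside one of the two copies; different first
   bits: a hypercubic or a complementary edge.  With empty tails the latter
   case is the single edge of AQ_1 = K_2. *)
Fixpoint aq_adj (x y : seq bool) : bool :=
  match x, y with
  | a :: x', b :: y' =>
      if a == b then aq_adj x' y' else (y' == x') || (y' == map negb x')
  | _, _ => false
  end.

Definition AQ (n : nat) : rel (n.-tuple bool) := fun x y => aq_adj x y.

Lemma AQ_irreflexive n : irreflexive (@AQ n).
Proof. by move=> x; rewrite /AQ; elim: (tval x) => //= a s ->; rewrite eqxx. Qed.

Lemma AQ_symmetric n : symmetric (@AQ n).
Proof.
move=> x y; rewrite /AQ; elim: (tval x) (tval y) => [|a s IH] [|b t] //=.
rewrite [b == a]eq_sym IH [s == t]eq_sym; congr (if _ then _ else _ || _).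
by apply/eqP/eqP => ->; rewrite (mapK negbK).
Qed.

Lemma AQ_connected n (x y : n.-tuple bool) : connect (@AQ n) x y.
Proof.
elim: n x y => [|n IH] x y; first by rewrite (tuple0 x) (tuple0 y).
have lift b (u v : n.-tuple bool) :
  connect (@AQ n) u v -> connect (@AQ n.+1) [tuple of b :: u] [tuple of b :: v].
  case/connectP=> p; elim: p u => [|w p IHp] u /= => [_ -> //|].
  case/andP=> uw /IHp wv /wv; apply: connect_trans.
  by apply: connect1; rewrite /AQ /= eqxx.
case/tupleP: x => a x; case/tupleP: y => b y.
apply: connect_trans (lift a x y (IH x y)) _.
have [-> //|neq] := eqVneq a b.
by apply: connect1; rewrite /AQ /= (negbTE neq) eqxx.
Qed.

(* Main.v *)
Require Import Defs.
From mathcomp Require Import all_boot.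
From mathcomp Require Import all_algebra zify.

(* Upper bound: a D-path with #|D| = 3 uses at least four of the arcs leaving D.
   If D has two common neighbours outside D, each of them wastes one of the
   3 (2n - 1) arcs leaving D, so 4 pi(D) + 2 <= 3 (2n - 1).

   Lower bound: in the basis of suffixes 0..01..1, AQ_n is the Cayley graph of F_2^n
   with generators d_j and d_j + d_(j+1). Adding d_1 to the vectors whose coordinate
   0 is nonzero preserves these generators, so one may assume that D = {x, y, z} is
   split as {x, y} | {z} by an interior coordinate i. With n = 2k, each of the two
   halves given by coordinate i is (4k - 4)-regular and (4k - 4)-connected, and
   every vertex has three neighbours in the other half. Menger's theorem gives 4k -
   4 disjoint x - y paths in the half of x and y. Keep 2k of them, and let the first
   vertices and the last vertices of the other 2k - 4 cross to the half of z along
   d_i; x and y also cross directly along two edges each. A fan from z to these 4k -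
   4 vertices yields 2k - 2 segments x - z and as many y - z, and the segments are
   then threaded into k + k + (k - 2) D-paths. *)

(** The constants are forced by degrees. Each D-path is built from two segments, so 3k - 2 paths
    need 6k - 4 segments. With 2k of them between x and y and 2k - 2 for each other pair, x and y
    spend 4k - 2 of their 4k - 1 edges, and 4k - 4 segments arrive at z, as many as z has edges
    inside its own half. Each cut strand yields one segment towards z from x and one from y; the
    direct crossings supply the rest: 2 (2k - 4) + 4 = 4k - 4. Two obstacles shape the construction.
    A strand whose first and last vertices coincide, at a common neighbour of x and y, cannot be
    cut, and the strands through the twins of the direct crossings must be kept. Together with a
    possible edge x - y these exceptions can number seven, one too many when k = 3; hence the bound
    of four on common neighbours and the rerouting argument. Moreover the second crossing d_i + g
    must satisfy y != x + g. An interior coordinate i offers g = d_(i-1) and g = d_(i+1), of which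
    one works; an end coordinate would offer only one candidate. *)

Set Implicit Arguments.
Unset Strict Implicit.
Unset Printing Implicit Defensive.

(** * D-paths assembled from segments *)

Section Assembly.
Variables (T : finType) (e : rel T).
Implicit Types (s t : seq T) (D : {set T}) (ss : seq (seq T)).

Lemma zip_behead_nth x0 s q : q \in zip s (behead s) ->
  exists2 i, i.+1 < size s & q = (nth x0 s i, nth x0 s i.+1).
Proof.
case: s => [|x s] //= /(nthP (x0, x0))[i]; rewrite size_zip /= => lti <-.
have lts : i < size s by move: lti; rewrite leq_min => /andP[].
exists i => //; rewrite nth_zip_cond size_zip lti /=; congr (_, _).
Qed.

Lemma zip_behead_mem s u v : (u, v) \in zip s (behead s) -> (u \in s) && (v \in s).
Proof.
case: s => [|x s] // /(zip_behead_nth x)[i lti [-> ->]].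
rewrite -[nth x s i]/(nth x (x :: s) i.+1).
by apply/andP; split; apply: mem_nth => //; apply: ltnW.
Qed.

Lemma zip_behead_index s u v : uniq s -> (u, v) \in zip s (behead s) ->
  [/\ u \in s, v \in s & index v s = (index u s).+1].
Proof.
case: s => [|x s] // us /(zip_behead_nth x)[i lti [-> ->]].
rewrite -[nth x s i]/(nth x (x :: s) i.+1); have lti' := ltnW lti.
by rewrite !mem_nth ?index_uniq.
Qed.

(** An edge with an end outside [D] belongs to a single path already by the vertex condition, so
    edge-disjointness has to be supplied only for edges inside [D]. *)
Lemma leq_pi_set D m (P : 'I_m -> seq T) : 1 < #|D| ->
  (forall i, is_Dpath e D (P i)) ->
  (forall i j v, v \in P i -> v \in P j -> v \notin D -> i = j) ->
  (forall i j u v u' v', u \in D -> v \in D ->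
     (u, v) \in zip (P i) (behead (P i)) -> (u', v') \in zip (P j) (behead (P j)) ->
     [set u; v] = [set u'; v'] -> i = j) ->
  m <= pi_set e D.
Proof.
move=> D2 PD PV PE.
have sizeP i : size (P i) <= #|T|.
  by case/andP: (PD i) => /and3P[_ _ /card_uniqP<-] _; apply: max_card.
pose f i : #|T|.-bseq T := Bseq (sizeP i).
have DP i v : v \in D -> v \in P i.
  by case/andP: (PD i) => _ /subsetP DPi /DPi; rewrite inE.
have edge_inj i j E : E \in path_edges (P i) -> E \in path_edges (P j) -> i = j.
  case/imsetP=> -[u v] /= uv ->; case/imsetP=> -[u' v'] /= uv' eqE.
  have /andP[ui vi] := zip_behead_mem uv; have /andP[u'j v'j] := zip_behead_mem uv'.
  have [uD|uD] := boolP (u \in D); last first.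
    apply: (PV i j u) => //; have : u \in [set u'; v'] by rewrite -eqE set21.
    by rewrite !inE => /orP[]/eqP->.
  have [vD|vD] := boolP (v \in D); last first.
    apply: (PV i j v) => //; have : v \in [set u'; v'] by rewrite -eqE set22.
    by rewrite !inE => /orP[]/eqP->.
  exact: (PE i j u v u' v').
(* Equal sequences share their first edge, which exists because a path through [D] has at least two
   vertices. *)
have f_inj : injective f.
  move=> i j /(congr1 (fun s : #|T|.-bseq T => s : seq T)) /= eqP.
  have sz2 : 1 < size (P i).
    case/andP: (PD i) => /and3P[_ _ uP] DPi; rewrite -(card_uniqP uP).
    by apply: leq_trans D2 _; apply: subset_leq_card; apply/subsetP=> v vD; apply: DP.
  case def_P : (P i) sz2 => [|u [|v s]] // _.
  by apply: (edge_inj _ _ [set u; v]); rewrite -?eqP def_P; apply/imsetP; exists (u, v);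
    rewrite //= mem_head.
rewrite -[m]card_ord -(card_imset predT f_inj) /pi_set.
apply: (bigmax_sup [set f i | i in predT]) => //.
apply/andP; split; first by apply/forall_inP=> _ /imsetP[i _ ->]; apply: PD.
apply/forall_inP=> _ /imsetP[i _ ->]; apply/forall_inP=> _ /imsetP[j _ ->].
rewrite (inj_eq f_inj); apply/implyP=> nij; apply/andP; split.
  apply/eqP/setP=> v; rewrite !inE; apply/andP/idP=> [[vi vj]|vD]; last by split; apply: DP.
  by apply: contraNT nij => vD; apply/eqP; apply: (PV i j v).
rewrite setI_eq0 disjoints_subset; apply/subsetP=> E Ei; rewrite inE.
by apply: contraNN nij => Ej; apply/eqP; apply: edge_inj Ei Ej.
Qed.

Definition thread (a : T) s (b : T) t (c : T) := a :: s ++ b :: rcons t c.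

Lemma mem_thread a s b t c v :
  (v \in thread a s b t c) = [|| v \in [:: a; b; c], v \in s | v \in t].
Proof.
rewrite /thread !inE mem_cat inE mem_rcons inE.
by do !case: (_ == _); do !case: (_ \in _).
Qed.

Lemma thread_uniq a s b t c : uniq [:: a; b; c] -> uniq s -> uniq t ->
  (forall v, v \in s -> (v \notin t) && (v \notin [:: a; b; c])) ->
  (forall v, v \in t -> v \notin [:: a; b; c]) -> uniq (thread a s b t c).
Proof.
rewrite /thread /= mem_cat cat_uniq /= !inE !mem_rcons rcons_uniq !inE !negb_or.
case/and3P=> /andP[ab ac] bc _ us ut sv tv.
have nt w : w \in [:: a; b; c] -> w \notin t by move=> wl; apply: contraTN wl => /tv.
have ns w : w \in [:: a; b; c] -> w \notin s by move=> wl; apply: contraTN wl => /sv/andP[].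
rewrite ab ac bc us ut !nt ?ns ?inE ?eqxx ?orbT //= andbT.
apply/hasPn=> w; rewrite mem_rcons inE => /predU1P[->|wt] /=.
  by rewrite ns // !inE eqxx !orbT.
by apply: contraL wt => /sv/andP[].
Qed.

(** Consecutive entries of a duplicate-free sequence have consecutive indices, and [a], [b], [c]
    stand at 0, [size s + 1] and [size s + size t + 2]. *)
Lemma thread_edge a s b t c u v : uniq (thread a s b t c) ->
  u \in [:: a; b; c] -> v \in [:: a; b; c] ->
  (u, v) \in zip (thread a s b t c) (behead (thread a s b t c)) ->
  [/\ u = a, v = b & s = [::]] \/ [/\ u = b, v = c & t = [::]].
Proof.
move=> us uD vD /(zip_behead_index us)[_ _].
have ia : index a (thread a s b t c) = 0 by rewrite /= eqxx.
have ib : index b (thread a s b t c) = (size s).+1.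
  rewrite -[X in index X _](_ : nth a (thread a s b t c) (size s).+1 = b) ?index_uniq //.
    by rewrite /= size_cat /=; lia.
  by rewrite /= nth_cat ltnn subnn.
have ic : index c (thread a s b t c) = (size s + size t).+2.
  rewrite -[X in index X _](_ : nth a (thread a s b t c) (size s + size t).+2 = c) ?index_uniq //.
    by rewrite /= size_cat /= size_rcons; lia.
  rewrite /= nth_cat -addnS; case: ltnP => [|_]; first by lia.
  by rewrite addKn /= nth_rcons ltnn eqxx.
move: uD vD; rewrite !inE; case/or3P=> /eqP->; case/or3P=> /eqP->;
  rewrite ?ia ?ib ?ic => eqi; try lia.
- by left; split=> //; apply: size0nil; lia.
- by right; split=> //; apply: size0nil; lia.
Qed.

Lemma uniq_flatten_nth ss i j v : uniq (flatten ss) ->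
  v \in nth [::] ss i -> v \in nth [::] ss j -> i = j.
Proof.
elim: ss i j => [|s ss IH] [|i] [|j] //=; rewrite ?nth_nil ?in_nil // cat_uniq.
- case/and3P=> _ /hasPn dis _ vs vj; have /dis : v \in flatten ss.
    apply/flattenP; exists (nth [::] ss j) => //; apply: mem_nth.
    by rewrite ltnNge; apply: contraL vj => /(nth_default [::])->.
  by rewrite /= vs.
- case/and3P=> _ /hasPn dis _ vj vs; have /dis : v \in flatten ss.
    apply/flattenP; exists (nth [::] ss i) => //; apply: mem_nth.
    by rewrite ltnNge; apply: contraL vj => /(nth_default [::])->.
  by rewrite /= vs.
- by case/and3P=> _ _ us vi vj; rewrite (IH i j).
Qed.

Lemma uniq_nth_flatten ss i : uniq (flatten ss) -> uniq (nth [::] ss i).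
Proof.
elim: ss i => [|s ss IH] [|i] //=; rewrite ?nth_nil // cat_uniq => /and3P[] //.
by move=> _ _ /IH.
Qed.

(** An empty segment is the direct edge between its two terminals. Allowing one per list keeps that
    edge from being used by two D-paths. *)
Lemma count_nilp_le1 ss i j : count (@nilp T) ss <= 1 -> i < size ss -> j < size ss ->
  nth [::] ss i = [::] -> nth [::] ss j = [::] -> i = j.
Proof.
have pos (ss' : seq (seq T)) k : k < size ss' -> nth [::] ss' k = [::] -> 0 < count (@nilp T) ss'.
  by move=> ltk nk; rewrite -has_count; apply/hasP; exists (nth [::] ss' k); rewrite ?mem_nth ?nk.
elim: ss i j => [|s ss IH] [|i] [|j] //=.
- by move=> le1 _ ltj s0 nj; have := pos ss j ltj nj; move: le1; rewrite s0 /=; lia.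
- by move=> le1 lti _ ni s0; have := pos ss i lti ni; move: le1; rewrite s0 /=; lia.
- by move=> le1 lti ltj ni nj; rewrite (IH i j) //; lia.
Qed.

Lemma path_rev_rcons x y s : symmetric e -> path e x (rcons s y) -> path e y (rcons (rev s) x).
Proof.
move=> sym exy; have := rev_path e x (rcons s y); rewrite last_rcons belast_rcons rev_cons => ->.
by rewrite (eq_path (e' := e)) // => u v; rewrite /= sym.
Qed.

(* The segments x - y, y - z, x - z numbered i are threaded through x for i < mx,
   through y for mx <= i < mx + my, and through z otherwise. *)
Lemma pi_set_segments x y z mx my mz (Sxy Syz Sxz : seq (seq T)) : symmetric e ->
  (forall s, s \in Sxy -> path e x (rcons s y)) ->
  (forall s, s \in Syz -> path e y (rcons s z)) ->
  (forall s, s \in Sxz -> path e x (rcons s z)) ->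
  size Sxy = mx + my -> size Syz = my + mz -> size Sxz = mx + mz ->
  count (@nilp T) Sxy <= 1 -> count (@nilp T) Syz <= 1 -> count (@nilp T) Sxz <= 1 ->
  uniq (x :: y :: z :: flatten (Sxy ++ Syz ++ Sxz)) ->
  mx + my + mz <= pi_set e [set x; y; z].
Proof.
move=> sym pxy pyz pxz szxy szyz szxz nxy nyz nxz.
set SS := Sxy ++ Syz ++ Sxz => uSS.
pose seg := nth [::] SS; pose o1 := mx + my; pose o2 := o1 + (my + mz).
have szSS : size SS = o2 + (mx + mz) by rewrite !size_cat szxy szyz szxz /o2 /o1; lia.
have seg_xy g : g < o1 -> seg g = nth [::] Sxy g by move=> ltg; rewrite /seg nth_cat szxy ltg.
have seg_yz g : seg (o1 + g) = if g < my + mz then nth [::] Syz g else seg (o1 + g).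
  case: ifP => // ltg; rewrite /seg nth_cat szxy ltnNge leq_addr /=.
  by rewrite /o1 addKn nth_cat szyz ltg.
have seg_xz g : seg (o2 + g) = nth [::] Sxz g.
  rewrite /seg !nth_cat szxy szyz; case: ltnP => [|_]; first by rewrite /o2 /o1; lia.
  have -> : o2 + g - (mx + my) = my + mz + g by rewrite /o2 /o1; lia.
  by rewrite ltnNge leq_addr /= addKn.
have uxyz : uniq [:: x; y; z].
  by move: uSS; rewrite (cat_uniq [:: x; y; z]) => /andP[].
have uF : uniq (flatten SS).
  by move: uSS; rewrite (cat_uniq [:: x; y; z]) => /and3P[].
have seg_D g v : v \in seg g -> v \notin [:: x; y; z].
  move=> vg; have : v \in flatten SS.
    apply/flattenP; exists (seg g) => //; apply: mem_nth.
    by rewrite ltnNge; apply: contraL vg => /(nth_default [::]); rewrite /seg => ->.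
  by move: uSS; rewrite (cat_uniq [:: x; y; z]) => /and3P[_ /hasPn dis _] /dis.
have seg_disj g h v : v \in seg g -> v \in seg h -> g = h by apply: uniq_flatten_nth.
have useg g : uniq (seg g) by apply: uniq_nth_flatten.
(* [g1 i] and [g2 i] are the positions in [SS] of the two segments of path [i]. The offsets are such
   that [Sxy] is used up by the paths through x and y, [Syz] by those through y and z, and [Sxz] by
   those through x and z. *)
pose g1 i := if i < o1 then i else o2 + (i - my).
pose g2 i := if i < mx then o2 + i else o1 + (i - mx).
pose P (i : 'I_(mx + my + mz)) :=
  if i < mx then thread y (rev (seg (g1 i))) x (seg (g2 i)) z
  else if i < o1 then thread x (seg (g1 i)) y (seg (g2 i)) z
  else thread x (seg (g1 i)) z (rev (seg (g2 i))) y.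
have memD v : (v \in [set x; y; z]) = (v \in [:: x; y; z]) by rewrite !inE orbA.
have memP i v : (v \in P i) = [|| v \in [:: x; y; z], v \in seg (g1 i) | v \in seg (g2 i)].
  rewrite /P; case: ifP => _; [|case: ifP => _]; rewrite mem_thread ?mem_rev //.
    by rewrite !inE; do !case: (_ == _).
  by rewrite !inE; do !case: (_ == _).
have use_inj (i j : 'I_(mx + my + mz)) g : g = g1 i \/ g = g2 i -> g = g1 j \/ g = g2 j -> i = j.
  have := ltn_ord i; have := ltn_ord j; rewrite /g1 /g2 /o2 /o1 => ltj lti gi gj.
  by apply: val_inj => /=; move: gi gj; do 4!case: ifP; lia.
have uP i : uniq (P i).
  have g12 : g1 i <> g2 i.
    have := ltn_ord i; rewrite /g1 /g2 /o2 /o1; do 2!case: ifP; lia.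
  have sD (w : seq T) g v : v \in seg g -> w =i [:: x; y; z] -> v \notin w.
    by move=> /seg_D nv ->.
  have yxz : [:: y; x; z] =i [:: x; y; z] by move=> v; rewrite !inE orbCA.
  have xzy : [:: x; z; y] =i [:: x; y; z] by move=> v; rewrite !inE [(v == z) || _]orbC.
  have dis v : v \in seg (g1 i) -> v \notin seg (g2 i).
    by move=> v1; apply/negP => v2; case: g12; apply: seg_disj v1 v2.
  rewrite /P; case: ifP => _; [|case: ifP => _]; apply: thread_uniq; rewrite ?rev_uniq //.
  - by move: uxyz; rewrite /= !inE !negb_or eq_sym => /and3P[/andP[-> ->] ->].
  - by move=> v; rewrite mem_rev => v1; rewrite dis // (sD _ _ _ v1).
  - by move=> v v1; rewrite (sD _ _ _ v1).
  - by move=> v v1; rewrite dis // (sD _ _ _ v1).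
  - by move=> v v1; rewrite (sD _ _ _ v1).
  - by move: uxyz; rewrite /= !inE !negb_or [z == y]eq_sym => /and3P[/andP[-> ->] ->].
  - by move=> v v1; rewrite mem_rev dis // (sD _ _ _ v1).
  - by move=> v; rewrite mem_rev => v1; rewrite (sD _ _ _ v1).
(* The terminals joined by segment [g]. An edge inside the triple comes from an empty segment
   ([edgeP]) and determines that segment ([pr_nil]), hence the path. *)
pose pr g := if g < o1 then [set x; y] else if g < o2 then [set y; z] else [set x; z].
have edgeP i u v : u \in [set x; y; z] -> v \in [set x; y; z] ->
    (u, v) \in zip (P i) (behead (P i)) ->
    exists g, [/\ g = g1 i \/ g = g2 i, seg g = [::], g < size SS & [set u; v] = pr g].
  rewrite !memD => uD vD; have := uP i; have lti := ltn_ord i.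
  have yxz w : (w \in [:: x; y; z]) = (w \in [:: y; x; z]) by rewrite !inE orbCA.
  have xzy w : (w \in [:: x; y; z]) = (w \in [:: x; z; y]) by rewrite !inE [(w == z) || _]orbC.
  have nil_rev (s : seq T) : rev s = [::] -> s = [::] by move/(congr1 rev); rewrite revK.
  rewrite /P /g1 /g2 /pr szSS; case: ltnP => lix; [|case: ltnP => liy] => uPi.
  - have lt1 : i < o1 by rewrite /o1; lia.
    rewrite lt1 in uPi *; rewrite yxz in uD; rewrite yxz in vD.
    case/(thread_edge uPi uD vD)=> -[-> -> sn]; [exists i | exists (o2 + i)].
      rewrite (nil_rev _ sn) setUC ifT; last by rewrite /o1; lia.
      by split=> //; [left | rewrite /o2 /o1; lia].
    rewrite !ifF; try by rewrite /o2 /o1; lia.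
    by split=> //; [right | rewrite /o2 /o1; lia].
  - case/(thread_edge uPi uD vD)=> -[-> -> sn]; [exists i | exists (o1 + (i - mx))].
      by rewrite liy; split=> //; [left | rewrite /o2 /o1; lia].
    rewrite ifF; last by lia.
    rewrite ifT; last by move: liy; rewrite /o2 /o1; lia.
    by split=> //; [right | move: liy; rewrite /o2 /o1; lia].
  - rewrite xzy in uD; rewrite xzy in vD.
    case/(thread_edge uPi uD vD)=> -[-> -> sn]; [exists (o2 + (i - my)) | exists (o1 + (i - mx))].
      rewrite !ifF; try by rewrite /o2 /o1; lia.
      by split=> //; [left | move: liy; rewrite /o2 /o1; lia].
    rewrite (nil_rev _ sn) setUC ifF; last by lia.
    rewrite ifT; last by move: liy; rewrite /o2 /o1; lia.
    by split=> //; [right | move: liy; rewrite /o2 /o1; lia].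
have pr_nil g h : g < size SS -> h < size SS ->
    pr g = pr h -> seg g = [::] -> seg h = [::] -> g = h.
  have [xy xz yz] : [/\ x != y, x != z & y != z].
    by move: uxyz; rewrite /= !inE negb_or => /and3P[/andP[]].
  have neq a b c d w : w \in [set a; b] -> w \notin [set c; d] ->
      [set a; b] <> [set c; d] :> {set T}.
    by move=> wab wcd eqab; rewrite -eqab wab in wcd.
  have segE k : k < size SS -> seg k = if k < o1 then nth [::] Sxy k
      else if k < o2 then nth [::] Syz (k - o1) else nth [::] Sxz (k - o2).
    move=> ltk; case: ltnP => [|le1]; first exact: seg_xy.
    case: ltnP => [lt2|le2]; first by
      rewrite -[in LHS](subnKC le1) seg_yz ifT //; move: lt2; rewrite /o2; lia.
    by rewrite -[in LHS](subnKC le2) seg_xz.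
  rewrite /pr szSS => ltg lth; rewrite !segE ?szSS //.
  case: (ltnP g o1) => g1'; [|case: (ltnP g o2) => g2'];
    (case: (ltnP h o1) => h1'; [|case: (ltnP h o2) => h2']); move=> eqp ng nh.
  - by apply: (count_nilp_le1 nxy) ng nh; rewrite szxy.
  - by exfalso; apply: (neq x y y z x) eqp; rewrite !inE ?eqxx // negb_or xy xz.
  - by exfalso; apply: (neq x y x z y) eqp; rewrite !inE ?eqxx ?orbT // negb_or eq_sym xy yz.
  - by exfalso; apply: (neq x y y z x) (esym eqp); rewrite !inE ?eqxx // negb_or xy xz.
  - by have := count_nilp_le1 nyz _ _ ng nh; rewrite szyz; rewrite /o2 in g2' h2'; lia.
  - by exfalso; apply: (neq x z y z x) (esym eqp); rewrite !inE ?eqxx ?orbT // negb_or xy xz.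
  - by exfalso; apply: (neq x y x z y) (esym eqp); rewrite !inE ?eqxx ?orbT // negb_or eq_sym xy yz.
  - by exfalso; apply: (neq x z y z x) eqp; rewrite !inE ?eqxx ?orbT // negb_or xy xz.
  - by have := count_nilp_le1 nxz _ _ ng nh; rewrite szxz; lia.
apply: (leq_pi_set (P := P)).
- by rewrite (eq_card memD) (card_uniqP uxyz).
- move=> i; rewrite /is_Dpath /is_path uP andbT; apply/andP; split; last first.
    by apply/subsetP=> v; rewrite memD => vD; rewrite inE memP vD.
  have path_thread a s b t c : path e a (rcons s b) -> path e b (rcons t c) ->
      sorted e (thread a s b t c).
    by move=> ps pt; rewrite /thread /= -cat_rcons cat_path last_rcons ps.
  have segP (ss : seq (seq T)) k : k < size ss -> nth [::] ss k \in ss by apply: mem_nth.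
  have lti := ltn_ord i; rewrite /P /g1 /g2; case: ltnP => lix; [|case: ltnP => liy].
  - have lt1 : i < o1 by rewrite /o1; lia.
    rewrite lt1 seg_xy // seg_xz; apply: path_thread.
      by apply: path_rev_rcons => //; apply/pxy/segP; rewrite szxy.
    by apply/pxz/segP; rewrite szxz; lia.
  - rewrite seg_xy // seg_yz ifT; last by move: liy; rewrite /o1; lia.
    apply: path_thread; first by apply/pxy/segP; rewrite szxy.
    by apply/pyz/segP; rewrite szyz; move: liy; rewrite /o1; lia.
  - rewrite seg_xz seg_yz ifT; last by move: liy; rewrite /o1; lia.
    apply: path_thread; first by apply/pxz/segP; rewrite szxz; move: liy; rewrite /o1; lia.
    by apply: path_rev_rcons => //; apply/pyz/segP; rewrite szyz; move: liy; rewrite /o1; lia.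
- move=> i j v; rewrite !memP memD => vi vj /negbTE nD; move: vi vj; rewrite nD /=.
  have inj := use_inj i j; case/orP=> vi; case/orP=> vj; have eqg := seg_disj _ _ _ vi vj.
  + by apply: (inj (g1 i)); left.
  + by apply: (inj (g1 i)); [left | right].
  + by apply: (inj (g2 i)); [right | left].
  + by apply: (inj (g2 i)); right.
- move=> i j u v u' v' uD vD uv uv' eqE.
  have [g [gi sg ltg pg]] := edgeP i u v uD vD uv.
  have [u'D v'D] : u' \in [set x; y; z] /\ v' \in [set x; y; z].
    have sE : [set u'; v'] \subset [set x; y; z] by rewrite -eqE subUset !sub1set uD.
    by move: sE; rewrite subUset !sub1set => /andP.
  have [h [hj sh lth ph]] := edgeP j u' v' u'D v'D uv'.
  apply: (use_inj i j g) => //; rewrite (pr_nil g h) //.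
  by rewrite -pg eqE.
Qed.

End Assembly.

(** * Upper bound by counting arcs at D *)

Lemma card_bigcup_disjoint (I T : finType) (P : {set I}) (A : I -> {set T}) :
  {in P &, forall i j, i != j -> [disjoint A i & A j]} ->
  #|\bigcup_(i in P) A i| = \sum_(i in P) #|A i|.
Proof.
move=> dis; pose A' i := if i \in P then A i else set0.
rewrite big_mkcond [RHS]big_mkcond /= -sum1_card (partition_disjoint_bigcup _ (fun=> 1)).
  by apply: eq_bigr => i _; rewrite sum1_card /A'; case: ifP => // _; rewrite cards0.
move=> i j ij; rewrite /A'; case: ifP => [iP|_]; last by rewrite disjoints_subset sub0set.
by case: ifP => [jP|_]; [apply: dis | rewrite disjoint_sym disjoints_subset sub0set].
Qed.

Section Upper.
Variables (T : finType) (e : rel T).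
Implicit Types (s : seq T) (D : {set T}).

Lemma set2_eq (a b u v : T) : a != b -> [set u; v] = [set a; b] ->
  (u = a /\ v = b) \/ (u = b /\ v = a).
Proof.
move=> nab eqE; have uE : u \in [set a; b] by rewrite -eqE set21.
have vE : v \in [set a; b] by rewrite -eqE set22.
have ab w : [set w; w] = [set a; b] -> False.
  move=> wE; have : a \in [set w; w] by rewrite wE set21.
  have : b \in [set w; w] by rewrite wE set22.
  by rewrite !inE !orbb => /eqP bw /eqP aw; rewrite bw aw eqxx in nab.
move: uE vE eqE; rewrite !inE => /orP[]/eqP-> /orP[]/eqP-> eqE; try by [left | right].
  by case: (ab a).
by case: (ab b).
Qed.

Lemma path_edgesP s u v : uniq s -> [set u; v] \in path_edges s ->
  [/\ u \in s, v \in s & index v s = (index u s).+1 \/ index u s = (index v s).+1].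
Proof.
move=> us /imsetP[[a b] /= /(zip_behead_index us)[sa sb iab] eqE].
have nab : a != b by apply: contra_eq_neq iab => ->; rewrite neq_ltn ltnSn.
by case: (set2_eq nab eqE) => -[-> ->]; split=> //; [left | right].
Qed.

Lemma path_edges_succ x0 s i : i.+1 < size s ->
  [set nth x0 s i; nth x0 s i.+1] \in path_edges s.
Proof.
move=> lti; apply/imsetP; exists (nth x0 s i, nth x0 s i.+1) => //.
have -> : (nth x0 s i, nth x0 s i.+1) = nth (x0, x0) (zip s (behead s)) i.
  by rewrite nth_zip_cond size_zip size_behead ifT ?nth_behead //; lia.
by rewrite mem_nth // size_zip size_behead; lia.
Qed.

Lemma path_edges_adj s u v : symmetric e -> sorted e s -> uniq s ->
  [set u; v] \in path_edges s -> e u v.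
Proof.
move=> sym es us uv; have [su sv idx] := path_edgesP us uv.
have adj i : i.+1 < size s -> e (nth u s i) (nth u s i.+1).
  by move/(sortedP u): es => /(_ i).
case: idx => eqi.
  have := adj (index u s); rewrite -eqi !nth_index // => -> //; by rewrite index_mem.
have := adj (index v s); rewrite -eqi !nth_index // sym => -> //; by rewrite index_mem.
Qed.

(** Ordered pairs, so that an edge with both ends in [D] counts once at each end, as it does in the
    sum of the degrees over [D]. *)
Definition arcs D s : {set T * T} :=
  [set q | (q.1 \in D) && ([set q.1; q.2] \in path_edges s)].

(** At least two vertices of [D] are not last on the path and have a successor, and at least two are
    not first and have a predecessor. A successor arc is never a predecessor arc, since the indices
    differ. *)
Lemma card_arcs D s : uniq s -> #|D| = 3 -> D \subset path_vertices s -> 4 <= #|arcs D s|.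
Proof.
move=> us D3 Ds; have [x0 Dx0] : exists x, x \in D by apply/card_gt0P; rewrite D3.
have sD u : u \in D -> u \in s by move/(subsetP Ds); rewrite inE.
pose nx u := (u, nth x0 s (index u s).+1); pose pv u := (u, nth x0 s (index u s).-1).
pose D1 := D :\ last x0 s; pose D2 := D :\ nth x0 s 0.
have D12 u : 2 <= #|D :\ u| by have := cardsD1 u D; have := leq_b1 (u \in D); rewrite D3; lia.
have i1 u : u \in D1 -> (u \in D) && ((index u s).+1 < size s).
  rewrite !inE => /andP[nl uD]; rewrite uD /=; have := sD u uD; rewrite -index_mem => lti.
  rewrite ltn_neqAle lti andbT; apply: contra nl => /eqP si.
  by rewrite -nth_last -si /= nth_index // sD.
have i2 u : u \in D2 -> (u \in D) && (0 < index u s).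
  rewrite !inE => /andP[nl uD]; rewrite uD /= lt0n; apply: contra nl => /eqP si.
  by rewrite -si nth_index // sD.
have nx_inj : injective nx by move=> u v [].
have pv_inj : injective pv by move=> u v [].
have dis : (nx @: D1) :&: (pv @: D2) = set0.
  apply/setP=> q; rewrite [RHS]inE; apply/setIP=> -[/imsetP[u /i1/andP[uD lti] ->]].
  case/imsetP=> v /i2/andP[vD lt0] [eqv]; rewrite -eqv in lt0 * => /eqP.
  have ltp : (index u s).-1 < size s by lia.
  rewrite nth_uniq // => /eqP eqi; lia.
apply: leq_trans (_ : #|(nx @: D1) :|: (pv @: D2)| <= _).
  by rewrite cardsU dis cards0 subn0 !card_imset //; apply: (leq_add (D12 _) (D12 _)).
apply: subset_leq_card; rewrite subUset; apply/andP; split; apply/subsetP=> _ /imsetP[u uD' ->].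
  have /andP[uD lti] := i1 u uD'; rewrite inE uD /=.
  by rewrite -{1}[u](nth_index x0 (sD u uD)); apply: path_edges_succ.
have /andP[uD lt0] := i2 u uD'; rewrite inE uD /= setUC.
rewrite -{2}[u](nth_index x0 (sD u uD)) -{2}(prednK lt0); apply: path_edges_succ.
by rewrite prednK // index_mem sD.
Qed.

Lemma pi_set_leq D d v1 v2 : symmetric e -> #|D| = 3 ->
  (forall u, u \in D -> #|[set v | e u v]| <= d) ->
  v1 != v2 -> v1 \notin D -> v2 \notin D ->
  (forall u, u \in D -> e u v1 && e u v2) ->
  pi_set e D <= (3 * d - 2) %/ 4.
Proof.
move=> sym D3 degD v12 D1 D2 Dv; apply/bigmax_leqP=> F /andP[/forall_inP FD /forall_inP FF].
have upath (P : #|T|.-bseq T) : P \in F -> uniq P by case/FD/andP=> /and3P[].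
have disj (P Q : #|T|.-bseq T) : P \in F -> Q \in F -> P != Q ->
    (path_vertices P :&: path_vertices Q = D) /\ (path_edges P :&: path_edges Q = set0).
  by move=> PF QF PQ; move/forall_inP: (FF P PF) => /(_ Q QF)/implyP/(_ PQ)/andP[/eqP-> /eqP->].
pose ED : {set T * T} := [set q | (q.1 \in D) && e q.1 q.2].
have cED : #|ED| <= 3 * d.
  have -> : #|ED| = \sum_(u in D) #|[set v | e u v]|.
    rewrite -sum1_card (eq_bigr (fun u => \sum_(v | e u v) 1)); last first.
      by move=> u _; rewrite sum1dep_card.
    by rewrite pair_big_dep /=; apply: eq_bigl => q; rewrite inE.
  by rewrite -D3 -sum_nat_const; apply: leq_sum.
have arcs_sub (P : #|T|.-bseq T) : P \in F -> arcs D P \subset ED.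
  move=> PF; apply/subsetP=> -[u v]; rewrite !inE /= => /andP[-> uv] /=.
  by case/andP: (FD P PF) => /and3P[_ eP uP] _; apply: path_edges_adj uv.
(* If all three arcs from [D] to [v] were used, one path would use them all, because [v] lies
   outside [D] and hence on at most one path. But [v] has at most two neighbours along a path. *)
have missing v : v \notin D -> exists2 u, u \in D & [forall P in F, (u, v) \notin arcs D P].
  move=> vD; apply/exists_inP; apply: contraT => /exists_inPn all_used.
  have used u : u \in D -> exists2 P : #|T|.-bseq T, P \in F & [set u; v] \in path_edges P.
    move=> uD; have := all_used u uD; rewrite negb_forall_in => /exists_inP[P PF].
    by rewrite negbK inE uD /=; exists P.
  have [u0 u0D] : exists x, x \in D by apply/card_gt0P; rewrite D3.
  have [P PF Pu0] := used u0 u0D; have [_ vP _] := path_edgesP (upath P PF) Pu0.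
  have Pu u : u \in D -> [set u; v] \in path_edges P.
    move=> uD; have [Q QF Qu] := used u uD; have [_ vQ _] := path_edgesP (upath Q QF) Qu.
    have [->//|/(disj _ _ PF QF)[eqD _]] := eqVneq P Q.
    by rewrite -eqD !inE vP vQ in vD.
  have : D \subset [set nth v P (index v P).-1; nth v P (index v P).+1].
    apply/subsetP=> u /Pu/(path_edgesP (upath P PF))[uP _ idx]; rewrite !inE.
    by case: idx => eqi; [rewrite eqi /= | rewrite -eqi]; rewrite nth_index ?eqxx ?orbT.
  by move/subset_leq_card; rewrite D3 cards2; case: (_ != _).
have [u1 u1D /forall_inP m1] := missing v1 D1; have [u2 u2D /forall_inP m2] := missing v2 D2.
have cover : \bigcup_(P in F) arcs D P \subset ED :\: [set (u1, v1); (u2, v2)].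
  apply/bigcupsP=> P PF; apply/subsetP=> q qP; rewrite inE (subsetP (arcs_sub P PF)) // andbT.
  rewrite !inE; apply/negP=> /orP[]/eqP def_q; rewrite def_q in qP.
    by move: (m1 P PF); rewrite qP.
  by move: (m2 P PF); rewrite qP.
have sum : \sum_(P in F) #|arcs D P| = #|\bigcup_(P in F) arcs D P|.
  rewrite card_bigcup_disjoint // => P Q PF QF /(disj P Q PF QF)[_ dE].
  rewrite -setI_eq0; apply/eqP/setP=> q.
  rewrite !inE; apply/negP=> /andP[/andP[_ qP] /andP[_ qQ]].
  by have := in_set0 [set q.1; q.2]; rewrite -dE inE qP qQ.
have le4 : 4 * #|F| <= \sum_(P in F) #|arcs D P|.
  rewrite mulnC -sum_nat_const; apply: leq_sum => P PF.
  by case/andP: (FD P PF) => /and3P[_ _ uP] DP; apply: card_arcs.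
rewrite leq_divRL // mulnC; apply: leq_trans le4 _; rewrite sum.
apply: leq_trans (subset_leq_card cover) _; rewrite cardsD (setIidPr _); last first.
  apply/subsetP=> q; rewrite !inE => /orP[]/eqP-> /=.
    by rewrite u1D; case/andP: (Dv u1 u1D).
  by rewrite u2D; case/andP: (Dv u2 u2D).
by rewrite cards2 xpair_eqE (negbTE v12) andbF /=; apply: leq_sub2r.
Qed.

End Upper.

(** * Menger's theorem *)

Section Menger.
Variable T : finType.
Implicit Types (e : rel T) (A B S : {set T}) (p : T -> seq T).

(** Only the head of an arc is tested, so the start of a path has to be kept out of [S]
    separately. *)
Definition avoiding e S : rel T := [rel u v | e u v && (v \notin S)].

Lemma path_avoiding e S a q :
  path (avoiding e S) a q = path e a q && all [predC S] q.
Proof.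
elim: q a => //= b q IH a; rewrite IH /= -!andbA; congr (_ && _).
by rewrite andbCA.
Qed.

Definition separates e A B S := forall a q,
  a \in A -> path e a q -> last a q \in B -> has (mem S) (a :: q).

(** The boolean form lets the existence of a small separator be decided by cases in the
    induction. *)
Lemma separatesP e A B S : reflect (separates e A B S)
  [forall a in A :\: S, forall b in B, ~~ connect (avoiding e S) a b].
Proof.
apply: (iffP forall_inP) => [sS a q Aa eq Bl|sS a].
  apply/negPn/negP; rewrite -all_predC /= => /andP[Sa Sq].
  have /sS/forall_inP/(_ _ Bl)/negP[] : a \in A :\: S by rewrite inE Sa.
  by apply/connectP; exists q; rewrite // path_avoiding eq.
rewrite inE => /andP[nSa Aa]; apply/forall_inP=> b Bb; apply/connectP=> -[q].
rewrite path_avoiding => /andP[eq Sq] def_b; rewrite def_b in Bb.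
by have := sS a q Aa eq Bb; apply/negP; rewrite -all_predC /= nSa.
Qed.

Definition linkage e A B p :=
  [/\ forall a, a \in A -> path e a (p a),
      forall a, a \in A -> last a (p a) \in B
    & forall a b v, a \in A -> b \in A ->
        v \in a :: p a -> v \in b :: p b -> a = b].

Lemma linkage_uniq e A B p : linkage e A B p ->
  exists2 p', linkage e A B p' & forall a, a \in A -> uniq (a :: p' a).
Proof.
case=> pe pB pD; exists (fun a => shorten a (p a)); last first.
  by move=> a Aa; case/shortenP: (pe a Aa).
have sub a : a \in A -> {subset a :: shorten a (p a) <= a :: p a}.
  move=> Aa; case/shortenP: (pe a Aa) => q _ _ sq v.
  by rewrite !inE => /predU1P[->|/sq->]; rewrite ?eqxx ?orbT.
split=> [a Aa|a Aa|a b v Aa Ab va vb].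
- by case/shortenP: (pe a Aa).
- by have := pB a Aa; case/shortenP: (pe a Aa).
- by apply: (pD _ _ v) => //; apply: sub.
Qed.

Lemma linkage_last_inj e A B p : linkage e A B p ->
  {in A &, injective (fun a => last a (p a))}.
Proof.
case=> _ _ pD a b Aa Ab /= eqab.
by apply: (pD a b (last a (p a))) => //; [|rewrite eqab]; apply: mem_last.
Qed.

Lemma linkage_onto e A B p : linkage e A B p -> #|B| <= #|A| ->
  forall b, b \in B -> exists2 a, a \in A & last a (p a) = b.
Proof.
move=> lp leBA b; have lB : [set last a (p a) | a in A] \subset B.
  by case: lp => _ pB _; apply/subsetP=> _ /imsetP[a Aa ->]; apply: pB.
have /eqP<- : [set last a (p a) | a in A] == B.
  by rewrite eqEcard lB (card_in_imset (linkage_last_inj lp)).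
by case/imsetP=> a Aa ->; exists a.
Qed.

Lemma path_first e S x q v : path e x q -> v \in x :: q -> v \in S ->
  exists q1 q2, [/\ q = q1 ++ q2, last x q1 \in S & all [predC S] (belast x q1)].
Proof.
elim: q x => [|y q IH] x /=.
  by move=> _; rewrite inE => /eqP-> Sx; exists [::], [::].
case/andP=> _ yq; have [Sx _ _|Sx] := boolP (x \in S); first by exists [::], (y :: q).
rewrite inE => /predU1P[->|vq]; first by rewrite (negbTE Sx).
case/(IH _ yq vq) => q1 [q2 [-> lS aS]].
by exists (y :: q1), q2; split=> //=; rewrite Sx.
Qed.

Lemma path_last S x q v : v \in x :: q -> v \in S ->
  exists y q1 q2, [/\ y \in S, x :: q = q1 ++ y :: q2 & all [predC S] q2].
Proof.
elim: q x v => [|y q IH] x v /=.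
  by rewrite inE => /eqP-> Sx; exists x, [::], [::].
have [/hasP[w wq Sw] _ _|nS] := boolP (has (mem S) (y :: q)).
  have [z [q1 [q2 [Sz -> aS]]]] := IH _ _ wq Sw.
  by exists z, (x :: q1), q2.
rewrite inE => /predU1P[-> Sx|vq Sv].
  by exists x, [::], (y :: q); rewrite all_predC.
by case/hasP: nS; exists v.
Qed.

(* The induction of F. Goering's proof: delete an arc (x, y).  If the rest has a
   separator S that is too small, then x |: S and y |: S are minimum separators of
   the full graph, and the linkages A -> x |: S and y |: S -> B, which avoid
   (x, y) and meet only in S, are glued along S and the arc (x, y). *)
Theorem menger e A B k : (forall S, separates e A B S -> k <= #|S|) ->
  exists A' p, [/\ A' \subset A, #|A'| = k & linkage e A' B p].
Proof.
have [m] := ubnP #|[set q : T * T | e q.1 q.2]|.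
elim: m e A B => // m IH e A B ltm sepk.
have [e0|] := eqVneq [set q : T * T | e q.1 q.2] set0.
  have /sepk kAB : separates e A B (A :&: B).
    move=> a [|b q] Aa /=; first by move=> _ Ba; rewrite inE Aa Ba.
    by case/andP=> eab; have := in_set0 (a, b); rewrite -e0 inE /= eab.
  have /card_geqP[s [us ss sAB]] := kAB.
  exists [set x in s], (fun _ => [::]); split.
  - by apply/subsetP=> x; rewrite inE => /sAB; rewrite inE => /andP[].
  - by rewrite cardsE (card_uniqP us).
  - split=> // [a|a b v]; first by rewrite inE => /sAB; rewrite inE => /andP[].
    by move=> _ _; rewrite !inE => /eqP-> /eqP.
case/set0Pn=> -[x y]; rewrite inE /= => exy.
pose e' := [rel u v | e u v && ((u, v) != (x, y))].
have e'e u q : path e' u q -> path e u q by apply: sub_path => a b /andP[].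
have ltm' : #|[set q : T * T | e' q.1 q.2]| < m.
  rewrite -ltnS; apply: leq_trans ltm; apply: proper_card.
  apply/properP; split; first by apply/subsetP=> -[u v]; rewrite !inE => /andP[].
  by exists (x, y); rewrite !inE //= eqxx andbF.
pose sepb S := [forall a in A :\: S, forall b in B, ~~ connect (avoiding e' S) a b].
have [/existsP[S /andP[/separatesP sS ltSk]]|/existsPn sep'] :=
  boolP [exists S, sepb S && (#|S| < k)]; last first.
  have [S sS|A' [p [sA cA [pe pB pD]]]] := IH e' A B ltm'.
    by move/separatesP: sS => sS; have := sep' S; rewrite /sepb sS -leqNgt.
  by exists A', p; split=> //; split=> // a /pe ea; apply: e'e.
(* The deleted arc is used only by leaving [x] and entering [y]. So a path that stops at its first
   visit to [x], or never enters [y] after its start, survives in [e']. *)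
have from_x a q : path e a q -> all (predC1 x) (belast a q) -> path e' a q.
  elim: q a => //= b q IHq a /andP[-> bq] /andP[ax abq].
  by rewrite xpair_eqE (negbTE ax) IHq.
have to_y a q : path e a q -> all (predC1 y) q -> path e' a q.
  elim: q a => //= b q IHq a /andP[-> bq] /andP[ax abq].
  by rewrite xpair_eqE (negbTE ax) andbF IHq.
have sepx : separates e A B (x |: S).
  move=> a q Aa eaq Bl; have [xq|/allPn[v vq]] := boolP (all (predC1 x) (belast a q)).
    have := sS a q Aa (from_x a q eaq xq) Bl; apply: sub_has => v.
    by rewrite !inE orbC => ->.
  move=> /negPn/eqP def_v; apply/hasP; exists x; last by rewrite /= setU11.
  by rewrite -def_v; apply: mem_belast.
have sepy : separates e A B (y |: S).
  move=> a q Aa eaq Bl; have [yq|/allPn[v vq]] := boolP (all (predC1 y) q).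
    have := sS a q Aa (to_y a q eaq yq) Bl; apply: sub_has => v.
    by rewrite !inE orbC => ->.
  move=> /negPn/eqP def_v; apply/hasP; exists y; last by rewrite /= setU11.
  by rewrite -def_v inE vq orbT.
have nSx : x \notin S.
  apply: contraL ltSk => Sx; rewrite -leqNgt.
  by have := sepk _ sepx; rewrite cardsU1 Sx.
have nSy : y \notin S.
  apply: contraL ltSk => Sy; rewrite -leqNgt.
  by have := sepk _ sepy; rewrite cardsU1 Sy.
have kx : #|x |: S| = k.
  by apply/eqP; rewrite eqn_leq sepk // cardsU1 nSx ltSk.
have ky : #|y |: S| = k.
  by apply/eqP; rewrite eqn_leq sepk // cardsU1 nSy ltSk.
(* A separator of [A] from [x |: S] in [e'] also separates [A] from [B] in [e]: every A - B path
   meets [x |: S], and up to the first such vertex it never leaves [x], so this part is a path of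
   [e']. The next linkage is symmetric, with the last vertex in [y |: S]. *)
have [|A1 [p1' [sA1 cA1 lp1']]] := IH e' A (x |: S) ltm'.
  move=> R sR; apply: sepk => a q Aa eaq Bl.
  have /hasP[v vq /= Sv] := sepx a q Aa eaq Bl.
  have [q1 [q2 [def_q lS aS]]] := path_first eaq vq Sv.
  have := eaq; rewrite def_q cat_path => /andP[eaq1 _].
  rewrite -[_ || _]/(has (mem R) ((a :: q1) ++ q2)) has_cat sR //; apply: from_x => //.
  by apply: sub_all aS => w /=; rewrite !inE negb_or => /andP[].
have [|A2 [p2' [sA2 cA2 lp2']]] := IH e' (y |: S) B ltm'.
  move=> R sR; apply: sepk => a q Aa eaq Bl.
  have /hasP[v vq /= Sv] := sepy a q Aa eaq Bl.
  have [w [q1 [q2 [Sw def_q aS]]]] := path_last vq Sv.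
  rewrite -[_ || _]/(has (mem R) (a :: q)) def_q has_cat sR ?orbT //.
    apply: to_y; last first.
      by apply: sub_all aS => z /=; rewrite !inE negb_or => /andP[].
    case: q1 def_q => [[<- <-] //|b q1 [def_a def_q]].
    by move: eaq; rewrite def_q cat_path /= => /and3P[].
  suff <- : last a q = last w q2 by [].
  by rewrite -[last a q]/(last a (a :: q)) def_q last_cat.
have {}cA2 : A2 = y |: S by apply/eqP; rewrite eqEcard sA2 cA2 ky leqnn.
subst A2; have [p1 lp1 up1] := linkage_uniq lp1'.
have [p2 lp2 up2] := linkage_uniq lp2'.
have [pe1 pS1 pD1] := lp1; have [pe2 pB2 pD2] := lp2.
pose f a := last a (p1 a).
have in_f a w : a \in A1 -> w \in S -> w \in a :: p1 a -> w = f a.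
  move=> A1a Sw wp; have [|b A1b def_w] := linkage_onto lp1 _ (setU1r x Sw).
    by rewrite kx cA1.
  rewrite -def_w; congr (f _); apply: (pD1 b a w) => //.
  by rewrite -def_w mem_last.
have in_s s w : s \in y |: S -> w \in S -> w \in s :: p2 s -> w = s.
  by move=> ys Sw ws; apply: (pD2 w s w); rewrite // ?mem_head ?setU1r.
(* Following [p1 a] up to [v] and then [p2 s] gives an A - B path of [e'], so it meets [S]. But
   [p1 a] meets [S] only at its last vertex and [p2 s] only at its first, so the meeting point is
   [v] itself. *)
have cross a s v : a \in A1 -> s \in y |: S -> v \in a :: p1 a -> v \in s :: p2 s ->
    (v \in S) && (v == f a) && (v == s).
  move=> A1a ys va vs.
  suff /orP Sv : (v \in S) || ((v == f a) && (f a \in S)) || ((v == s) && (s \in S)).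
    have {}Sv : v \in S.
      by case: Sv => [/orP[//|/andP[/eqP->]]|/andP[/eqP->]].
    by rewrite Sv -(in_f a v) // (in_s s v) // eqxx.
  have := pe1 a A1a; have := pe2 s ys; have := up1 a A1a; have := up2 s ys.
  have := in_f a ^~ A1a; have := in_s s ^~ ys; rewrite /f.
  have := pB2 s ys.
  case/splitPl: va => q1 q1' lq1; case/splitPl: vs => q2 q2' lq2.
  rewrite !last_cat !lq1 !lq2 !cat_path lq1 lq2 => Bl ins inf u2 u1.
  case/andP=> _ ev; case/andP=> ea _.
  have := sS a (q1 ++ q2') (subsetP sA1 a A1a).
  rewrite cat_path last_cat lq1 ea => /(_ ev Bl) /hasP[w wq /= Sw].
  move: wq; rewrite -cat_cons mem_cat => /orP[w1|w2].
    have def_w : w = last v q1'.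
      by apply: inf; rewrite // -cat_cons mem_cat w1.
    case: (lastP q1') def_w u1 => [|q1'' z]; first by move=> /= <-; rewrite Sw.
    rewrite last_rcons -cat_cons cat_uniq => <- /and3P[_ /hasPn/(_ w)].
    by rewrite mem_rcons mem_head => /(_ isT)/=; rewrite w1.
  have def_w : w = s by apply: ins; rewrite // -cat_cons mem_cat w2 orbT.
  move: u2; rewrite -cat_cons cat_uniq => /and3P[_ /hasPn/(_ w w2)/=].
  by rewrite def_w mem_head.
(* The start of the second half of the path from [a]: its end point in [S], or [y] after crossing
   the deleted arc when the first half ends at [x]. *)
pose g a := if f a == x then y else f a.
have A1g a : a \in A1 -> g a \in y |: S.
  move=> /pS1; rewrite -/(f a) /g; case: eqP => [_ _|nx]; first exact: setU11.
  by rewrite !inE => /predU1P[//|->]; rewrite orbT.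
have f_inj := linkage_last_inj lp1.
have g_inj : {in A1 &, injective g}.
  move=> a b A1a A1b; rewrite /g => eqg; apply: f_inj => //=; rewrite -!/(f _).
  move: eqg (pS1 a A1a) (pS1 b A1b); rewrite -!/(f _) !inE.
  case: eqP => [->|_]; case: eqP => [->|_] //=; first by move=> <-; rewrite (negbTE nSy).
  by move=> ->; rewrite (negbTE nSy).
pose p a := p1 a ++ (if f a == x then y :: p2 y else p2 (f a)).
have in_p a v : a \in A1 -> v \in a :: p a -> (v \in a :: p1 a) || (v \in g a :: p2 (g a)).
  move=> A1a; rewrite /p /g -cat_cons mem_cat; case: (f a == x) => //.
  by case/orP=> [->//|v2]; rewrite !inE v2 !orbT.
exists A1, p; split=> //; split=> [a A1a|a A1a|a b v A1a A1b va vb].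
- rewrite cat_path e'e ?pe1 //= -/(f a); case: eqP (A1g a A1a) => fx; rewrite /g.
    by rewrite fx eqxx => ys; rewrite /= exy e'e ?pe2.
  by case: eqP => // _ ys; rewrite e'e ?pe2.
- rewrite last_cat -/(f a); have := pB2 _ (A1g a A1a); rewrite /g.
  by case: eqP.
case/orP: (in_p a v A1a va) => {}va; case/orP: (in_p b v A1b vb) => {}vb.
- exact: (pD1 a b v).
- have /andP[/andP[Sv /eqP def_v] /eqP def_v2] := cross a (g b) v A1a (A1g b A1b) va vb.
  apply: f_inj => //=; rewrite -!/(f _) -def_v def_v2 /g; case: eqP => // fx.
  by move: Sv; rewrite def_v2 /g fx eqxx (negbTE nSy).
- have /andP[/andP[Sv /eqP def_v] /eqP def_v2] := cross b (g a) v A1b (A1g a A1a) vb va.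
  apply: f_inj => //=; rewrite -!/(f _) -def_v def_v2 /g; case: eqP => // fx.
  by move: Sv; rewrite def_v2 /g fx eqxx (negbTE nSy).
by apply: g_inj => //; apply: (pD2 _ _ v) => //; apply: A1g.
Qed.

End Menger.

Import GRing.Theory.

(** * Connectivity of subcubes *)

Lemma connect_inv (T : finType) (P : pred T) (e e' : rel T) x y :
  (forall a b, P a -> e' a b -> e a b && P b) -> P x ->
  connect e' x y -> connect e x y.
Proof.
move=> ee' Px /connectP[q]; elim: q x Px => [|a q IH] x Px /=; first by move=> _ ->.
case/andP=> /(ee' _ _ Px)/andP[exa Pa] aq def_y.
exact: connect_trans (connect1 exa) (IH a Pa aq def_y).
Qed.

Section Cube.
Local Open Scope ring_scope.
Variable n : nat.
Local Notation V := {ffun 'I_n -> bool}.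
Implicit Types (u v w g : V) (I : {set 'I_n}) (X : {set V}).

Lemma cubeDE u v t : (u + v) t = u t (+) v t. Proof. by rewrite ffunE. Qed.
Lemma cubeDD u : u + u = 0.
Proof. by apply/ffunP=> t; rewrite cubeDE addbb ffunE. Qed.
Lemma cubeDK u : cancel (+%R^~ u) (+%R^~ u).
Proof. by move=> v; rewrite -addrA cubeDD addr0. Qed.
Lemma cubeKD u : cancel (+%R u) (+%R u).
Proof. by move=> v; rewrite addrA cubeDD add0r. Qed.
Lemma cubeD_eq0 u v : (u + v == 0) = (u == v).
Proof. by rewrite -[0](cubeDD v) (inj_eq (addIr v)). Qed.

Definition supp v : {set 'I_n} := [set t | v t].

Lemma suppS I v : reflect (forall t, t \notin I -> v t = false) (supp v \subset I).
Proof.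
apply: (iffP subsetP) => [sI t|vI t]; last first.
  by rewrite inE; apply: contraTT => /vI->.
by apply: contraNF => vt; apply: sI; rewrite inE.
Qed.

Lemma suppD I u v : supp u \subset I -> supp v \subset I -> supp (u + v) \subset I.
Proof.
move=> /suppS uI /suppS vI; apply/suppS=> t It.
by rewrite cubeDE uI ?vI.
Qed.

Lemma supp_trans I v u w : supp (u + v) \subset I -> supp (v + w) \subset I ->
  supp (u + w) \subset I.
Proof. by move=> uv vw; rewrite -(cubeDK v u) -addrA; apply: suppD. Qed.

Definition gen (b : bool) (j : nat) : V :=
  [ffun t : 'I_n => (t == j :> nat) || b && (t == j.+1 :> nat)].
(* For j = n - 1 both values of b give the last basis vector. *)
Definition gens : {set V} := [set gen q.1 q.2 | q : bool * 'I_n].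

Lemma gen_in b j : (j < n)%N -> gen b j \in gens.
Proof. by move=> ltj; apply/imsetP; exists (b, Ordinal ltj). Qed.

Definition cadj I : rel V :=
  [rel u v | (u + v \in gens) && (supp (u + v) \subset I)].

(** Connectivity of the cosets of the subspace supported on [I]. No lower bound on the size of a
    coset is included, so one-vertex cosets satisfy this for every [d] ([conn0]). *)
Definition conn I d := forall X u v, (#|X| < d)%N -> u \notin X -> v \notin X ->
  supp (u + v) \subset I -> connect (avoiding (cadj I) X) u v.

Lemma conn0 d : conn set0 d.
Proof.
move=> X u v _ _ _; rewrite subset0 => /eqP s0.
suff -> : u = v by apply: connect0.
apply/eqP; rewrite -cubeD_eq0; apply/eqP/ffunP=> t.
by have := in_set0 t; rewrite -s0 inE => ->; rewrite ffunE.
Qed.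

Lemma card_coset I u : (2 ^ #|I| <= #|[set w | supp (u + w)%R \subset I]|)%N.
Proof.
pose f (A : {set 'I_n}) : V := u + [ffun t => t \in A].
rewrite -card_powerset -(card_imset (f := f)); last first.
  move=> A B /addrI/ffunP eqAB; apply/setP=> t; by have := eqAB t; rewrite !ffunE.
apply: subset_leq_card; apply/subsetP=> _ /imsetP[A AI ->]; rewrite inE cubeKD.
apply/suppS=> t tI; rewrite ffunE; apply: contraNF tI => tA.
by move: AI; rewrite powersetE => /subsetP->.
Qed.

(* Removing X leaves both halves connected, and joined by an edge along i, unless one
   half loses at least d' vertices; then the other loses fewer than #|C|, so it stays
   connected and every vertex of the first half keeps a neighbour in it. *)
Lemma conn_step I i d d' (C : {set V}) : i \notin I -> conn I d' ->
  (forall g, g \in C -> [/\ g \in gens, supp g \subset i |: I & g i]) ->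
  (d <= d' + #|C|)%N -> (#|C| <= d')%N -> (d <= 2 ^ #|I|)%N -> conn (i |: I) d.
Proof.
move=> nIi cI CP ledd leCd' le2 X u v ltX uX vX uv.
pose H s := [set w : V in X | w i == s].
have cH s : (#|H s| + #|H (~~ s)| = #|X|)%N.
  rewrite -(cardsID [set w : V | w i == s] X).
  congr (_ + _)%N; apply: eq_card => w; rewrite !inE //.
  by rewrite andbC; case: (w i) s => -[].
have loc s a b : (#|H s| < d')%N -> a \notin X -> b \notin X -> a i = s -> b i = s ->
    supp (a + b) \subset i |: I -> connect (avoiding (cadj (i |: I)) X) a b.
  move=> ltH aX bX ai bi /suppS ab.
  apply: (connect_inv (P := [pred w : V | w i == s]) (e' := avoiding (cadj I) (H s))).
  - move=> w w' /eqP wi /andP[/andP[gw sw] w'X]; rewrite /avoiding /cadj /= gw.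
    have /eqP wi' : w' i == s.
      by move/suppS: (sw) => /(_ i nIi); rewrite cubeDE wi; case: (w' i) s {ltH ai bi wi w'X} => -[].
    move: w'X; rewrite inE wi' eqxx andbT => ->; rewrite (subset_trans sw) //.
    exact: subsetUr.
  - by rewrite /= ai.
  - apply: cI; rewrite ?inE ?negb_and ?aX ?bX //; apply/suppS=> t tI.
    have [->|nti] := eqVneq t i; first by rewrite cubeDE ai bi addbb.
    by apply: ab; rewrite !inE negb_or nti.
have hop g a : g \in C -> a + g \notin X ->
    connect (avoiding (cadj (i |: I)) X) a (a + g).
  by move=> /CP[gg sg _] aX; apply: connect1; rewrite /avoiding /cadj /= cubeKD gg sg.
have [/andP[lt0 lt1]|] := boolP ((#|H true| < d')%N && (#|H false| < d')%N).
  have lts s : (#|H s| < d')%N by case: s.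
  have [eqi|neqi] := eqVneq (u i) (v i); first exact: (loc (v i)).
  (* The edges along [i] that leave the coset of [u] are pairwise disjoint and number at least
     [2 ^ #|I|]. As [X] has fewer vertices than that, it misses both ends of one of them. *)
  have [w /and3P[uw wX wX']] : exists w, [&& supp (u + w) \subset I, w \notin X
        & w + gen false i \notin X].
    apply/existsP; apply: contraTT (ltX); rewrite -leqNgt => /existsPn bad.
    apply: leq_trans le2 _; apply: leq_trans (card_coset I u) _.
    have wi w : supp (u + w) \subset I -> w i = u i.
      by move/suppS/(_ i nIi); rewrite cubeDE; case: (u i) (w i) => -[].
    pose h w := if w \in X then w else w + gen false i.
    rewrite -(card_in_imset (f := h)).
      apply: subset_leq_card; apply/subsetP=> _ /imsetP[w uw ->]; rewrite inE in uw.
      rewrite /h; case: ifPn => // wX; have := bad w; rewrite uw wX /=.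
      by move/negPn.
    have gi : gen false i i by rewrite ffunE eqxx.
    move=> w w'; rewrite !inE => /wi wi1 /wi wi2; rewrite /h.
    case: ifP => _; case: ifP => _ // eqw; last exact: addIr eqw.
      by have := congr1 (fun z : V => z i) eqw; rewrite cubeDE wi1 wi2 gi; case: (u i).
    by have := congr1 (fun z : V => z i) eqw; rewrite cubeDE wi1 wi2 gi; case: (u i).
  have uwI : supp (u + w) \subset i |: I by apply: subset_trans uw (subsetUr _ _).
  have wi : w i = u i.
    by move/suppS: uw => /(_ i nIi); rewrite cubeDE; case: (u i) (w i) => -[].
  have giI : supp (gen false i) \subset i |: I.
    apply/suppS=> t; rewrite !inE ffunE orbF => /norP[nti _].
    exact/negbTE.
  apply: connect_trans (loc (u i) u w (lts _) uX wX erefl wi uwI) _.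
  apply: connect_trans (_ : connect _ w (w + gen false i)) _.
    by apply: connect1; rewrite /avoiding /cadj /= cubeKD gen_in ?ltn_ord // giI.
  apply: (loc (v i)) => //.
    rewrite cubeDE wi ffunE eqxx /=.
    by case: (u i) (v i) neqi => -[].
  apply: (supp_trans (v := u)) => //.
  by apply: (supp_trans (v := w)); rewrite ?[w + u]addrC // -addrA addrC cubeDK.
move=> nlt; have [s leH] : exists s, (d' <= #|H s|)%N.
  by case/nandP: nlt; rewrite -leqNgt; [exists true | exists false].
have ltH : (#|H (~~ s)| < #|C|)%N by have := cH s; lia.
have side a : a \notin X -> exists2 b, [/\ b \notin X, b i = ~~ s & supp (a + b) \subset i |: I]
    & connect (avoiding (cadj (i |: I)) X) a b /\ connect (avoiding (cadj (i |: I)) X) b a.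
  move=> aX; have [ai|nai] := eqVneq (a i) (~~ s).
    exists a; last by rewrite !connect0.
    by split=> //; rewrite cubeDD; apply/suppS=> t _; rewrite ffunE.
  have {nai}ai : a i = s by case: (a i) s nai {leH ltH} => -[].
  have [g Cg gX] : exists2 g, g \in C & a + g \notin X.
    apply/exists_inP; apply: contraTT ltH => /exists_inPn bad; rewrite -leqNgt.
    rewrite -(card_imset _ (addrI a)); apply: subset_leq_card.
    apply/subsetP=> _ /imsetP[g Cg ->]; have := bad g Cg; rewrite negbK inE => ->.
    by have [_ _ gi] := CP g Cg; rewrite cubeDE ai gi; case: (s).
  have [gg sg gi] := CP g Cg; exists (a + g).
    by rewrite gX cubeKD cubeDE ai gi addbT.
  split; first exact: hop.
  by rewrite -{2}(cubeDK g a); apply: hop; rewrite ?cubeDK.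
have [a [aX ai ua] [cua _]] := side u uX; have [b [bX bi vb] [_ cbv]] := side v vX.
apply: connect_trans cua (connect_trans _ cbv).
apply: (loc (~~ s)) => //; first by apply: leq_trans ltH leCd'.
apply: (supp_trans (v := u)); first by rewrite addrC.
exact: (supp_trans (v := v)).
Qed.

Lemma supp_gen b j I :
  (forall t : 'I_n, t \notin I -> (t != j :> nat) && ~~ (b && (t == j.+1 :> nat))) ->
  supp (gen b j) \subset I.
Proof.
move=> jI; apply/suppS=> t /jI/andP[ntj ntb]; rewrite ffunE.
by rewrite (negbTE ntj) (negbTE ntb).
Qed.

Lemma gen_neq b j : (j.+1 < n)%N -> gen false b != gen true j.
Proof.
move=> ltj; apply/eqP=> /ffunP eqg.
have := eqg (Ordinal (ltnW ltj)); have := eqg (Ordinal ltj).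
by rewrite !ffunE /=; lia.
Qed.

Definition punctured (i a b : nat) : {set 'I_n} :=
  [set t : 'I_n | (a <= t <= b)%N && (t != i :> nat)].

(** The new coordinate [i] is next to [j] in [I], so it comes with two generators, d_i and d_i +
    d_j. The size bound is renewed so that the lemma can be iterated. *)
Lemma conn_add2 I (i j : 'I_n) d : i \notin I ->
  (j = i.+1 :> nat) \/ (i = j.+1 :> nat) -> j \in I ->
  conn I d -> (2 <= d)%N -> (d.+2 <= 2 ^ #|I|)%N ->
  conn (i |: I) d.+2 /\ (d.+4 <= 2 ^ #|i |: I|)%N.
Proof.
move=> nIi ij Ij cI le2d ledI; split; last first.
  have -> : #|i |: I| = #|I|.+1 by rewrite cardsU1 nIi.
  by rewrite expnS; move: (2 ^ _)%N ledI => z; lia.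
pose m := minn i j.
have ltmn : (m.+1 < n)%N by have := ltn_ord i; have := ltn_ord j; rewrite /m; lia.
apply: (conn_step (d' := d) (C := [set gen false i; gen true m])); 
  rewrite ?cards2 ?gen_neq //; try lia.
move=> g; rewrite !inE => /orP[/eqP->|/eqP->].
  rewrite gen_in ?ltn_ord //; split=> //; last by rewrite ffunE eqxx.
  by apply: supp_gen => t; rewrite !inE andbT => /norP[].
rewrite gen_in 1?ltnW //; split=> //; last by rewrite ffunE /m; lia.
apply: supp_gen => t; rewrite !inE => /norP[nti ntI]; have : t != j by apply: contraNneq ntI => ->.
move: nti; rewrite -!val_eqE /= /m; lia.
Qed.

(** Induction on the length of the interval. For the smallest one, d_(i-1) and d_(i+1) span a
    4-cycle; each further coordinate is next to an earlier one and raises the connectivity by two.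
    The full range 0 .. n - 1 gives 2 (n - 1) - 2 = 2n - 4, the degree in a half. *)
Lemma conn_punctured i a b : (a < i)%N -> (i < b)%N -> (b < n)%N ->
  conn (punctured i a b) (2 * (b - a) - 2)%N /\ (2 * (b - a) <= 2 ^ #|punctured i a b|)%N.
Proof.
have [m] := ubnP (b - a)%N; elim: m a b => // m IH a b ltm lta ltb ltn.
have [/eqP def_a|nea] := boolP (a.+1 == i); last first.
  have ltan : (a < n)%N by lia.
  have lta1 : (a.+1 < n)%N by lia.
  have -> : punctured i a b = Ordinal ltan |: punctured i a.+1 b.
    by apply/setP=> t; rewrite !inE -val_eqE /=; lia.
  have [||||cI leI] := IH a.+1 b; try lia.
  have := @conn_add2 (punctured i a.+1 b) (Ordinal ltan) (Ordinal lta1) _ _ _ _ cI.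
  have -> : (2 * (b - a) - 2 = (2 * (b - a.+1) - 2).+2)%N by lia.
  have -> : (2 * (b - a) = (2 * (b - a.+1) - 2).+4)%N by lia.
  by apply; [rewrite inE /=; lia | rewrite /=; lia | rewrite inE /=; lia | lia |
    move: (2 ^ _)%N leI => z; lia].
have [/eqP def_b|neb] := boolP (i.+1 == b); last first.
  have ltb1 : (b.-1 < n)%N by lia.
  have -> : punctured i a b = Ordinal ltn |: punctured i a b.-1.
    by apply/setP=> t; rewrite !inE -val_eqE /=; lia.
  have [||||cI leI] := IH a b.-1; try lia.
  have := @conn_add2 (punctured i a b.-1) (Ordinal ltn) (Ordinal ltb1) _ _ _ _ cI.
  have -> : (2 * (b - a) - 2 = (2 * (b.-1 - a) - 2).+2)%N by lia.
  have -> : (2 * (b - a) = (2 * (b.-1 - a) - 2).+4)%N by lia.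
  by apply; [rewrite inE /=; lia | rewrite /=; lia | rewrite inE /=; lia | lia |
    move: (2 ^ _)%N leI => z; lia].
have ltan : (a < n)%N by lia.
have -> : punctured i a b = Ordinal ltan |: (Ordinal ltn |: set0).
  by apply/setP=> t; rewrite !inE -!val_eqE /=; lia.
have nin : Ordinal ltan \notin Ordinal ltn |: set0.
  by rewrite !inE -val_eqE /=; lia.
have -> : (b - a = 2)%N by lia.
split; last by rewrite cardsU1 nin cardsU1 inE cards0.
have single j I : supp (gen false (j : 'I_n)) \subset j |: I.
  by apply: supp_gen => t; rewrite !inE -val_eqE /=; lia.
apply: (conn_step (d' := 1) (C := [set gen false a])); rewrite ?cards1 //.
- apply: (conn_step (d' := 1) (C := [set gen false b])); rewrite ?cards1 ?cards0 ?inE //.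
    exact: conn0.
  move=> g; rewrite inE => /eqP->; rewrite gen_in //; split=> //; last by rewrite ffunE eqxx.
  exact: (single (Ordinal ltn)).
- move=> g; rewrite inE => /eqP->; rewrite gen_in //; split=> //; last by rewrite ffunE eqxx.
  exact: (single (Ordinal ltan)).
- by rewrite cardsU1 inE cards0.
Qed.

End Cube.

(** * Counting generators *)

Section Gens.
Local Open Scope ring_scope.
Variable n : nat.
Local Notation V := {ffun 'I_n -> bool}.
Implicit Types (u v w g h a : V).

Lemma gen_last : gen n true n.-1 = gen n false n.-1.
Proof. by apply/ffunP=> t; rewrite !ffunE /=; have := ltn_ord t; lia. Qed.

(** One index for each generator: only the duplicate [(true, n - 1)] is left out. *)
Definition proper_index : {set bool * 'I_n} := [set q : bool * 'I_n | q.1 ==> (q.2.+1 < n)%N].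

Lemma gen_inj : {in proper_index &, injective (fun q : bool * 'I_n => gen n q.1 q.2)}.
Proof.
move=> [b j] [c k]; rewrite !inE /= => jP kP /ffunP eqg.
have := eqg j; have := eqg k; rewrite !ffunE !eqxx /= => eqk eqj.
have def_j : j = k by apply: val_inj => /=; lia.
subst k; congr (_, _); have [bc|] := boolP (b || c); last by case: b c {jP kP eqk eqj eqg} => -[].
have ltj : (j.+1 < n)%N by case/orP: bc => [bT|cT]; rewrite ?bT ?cT in jP kP.
by have := eqg (Ordinal ltj); rewrite !ffunE /=; lia.
Qed.

Lemma gens_proper : gens n = [set gen n q.1 q.2 | q : bool * 'I_n in proper_index].
Proof.
apply/setP=> v; apply/imsetP/imsetP=> -[[b j] _ ->]; last by exists (b, j).
have [Pj|] := boolP ((b, j) \in proper_index); first by exists (b, j).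
rewrite inE /= negb_imply -leqNgt => /andP[-> lej].
exists (false, j); rewrite ?inE //=.
have -> : val j = n.-1 by have := ltn_ord j; rewrite /=; lia.
exact: gen_last.
Qed.

Lemma card_proper_index : (0 < n)%N -> #|proper_index| = (2 * n).-1.
Proof.
move=> n0; have ltn1 : (n.-1 < n)%N by lia.
have -> : proper_index = [set~ (true, Ordinal ltn1)].
  by apply/setP=> -[b j]; rewrite !inE xpair_eqE -val_eqE /=; have := ltn_ord j; lia.
by rewrite cardsC1 card_prod card_bool card_ord.
Qed.

Lemma card_gens : (0 < n)%N -> #|gens n| = (2 * n).-1.
Proof. by move=> n0; rewrite gens_proper (card_in_imset gen_inj) card_proper_index. Qed.

(** Exactly three of the 2n - 1 generators involve an interior coordinate [i]: d_i, d_i + d_(i+1)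
    and d_(i-1) + d_i. *)
Lemma card_half_gens (i : 'I_n) : (0 < i)%N -> (i.+1 < n)%N ->
  #|[set g in gens n | ~~ g i]| = (2 * n - 4)%N.
Proof.
move=> i0 ltin; have lti1 : (i.-1 < n)%N by lia.
have -> : [set g in gens n | ~~ g i] =
    [set gen n q.1 q.2 | q : bool * 'I_n in
      proper_index :\: [set (false, i); (true, i); (true, Ordinal lti1)]].
  apply/setP=> v; rewrite inE gens_proper; apply/andP/imsetP.
    case=> /imsetP[[b j] Pj ->] /=; rewrite ffunE => ni; exists (b, j) => //.
    by rewrite inE Pj andbT !inE !xpair_eqE -!val_eqE /=; lia.
  case=> -[b j]; rewrite inE => /andP[nj Pj] ->; split; first by apply/imsetP; exists (b, j).
  by move: nj; rewrite ffunE !inE !xpair_eqE -!val_eqE /=; lia.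
rewrite card_in_imset; last first.
  by move=> q r; rewrite inE => /andP[_ qP]; rewrite inE => /andP[_ rP]; apply: gen_inj.
have n0 : (0 < n)%N by lia.
rewrite cardsD (setIidPr _) ?card_proper_index //.
  rewrite -setUA cardsU1 cards2 !inE !xpair_eqE -!val_eqE /= eqn_leq.
  by have := ltn_ord i; lia.
by apply/subsetP=> -[b j]; rewrite !inE !xpair_eqE -!val_eqE /=; lia.
Qed.

(** Let [m] be the lowest coordinate of [h]. Of two generators with sum [h], one starts at [m],
    unless both start at [m - 1], which forces h = d_m. In general this leaves the two generators
    starting at [m] and their complements to [h]. When h = d_m, the choice g = d_m would leave the
    sum 0, so that pair drops out and makes room for the two generators starting at [m - 1]. *)
Lemma card_common_gens h : h != 0 -> (#|[set g in gens n | (h + g)%R \in gens n]| <= 4)%N.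
Proof.
move=> nz; have [m hm minm] : exists2 m, h m & forall t, h t -> (m <= t)%N.
  have [t ht] : exists t, h t.
    apply/existsP; apply: contraNT nz => /existsPn h0; apply/eqP/ffunP=> t.
    by rewrite [RHS]ffunE; apply/negbTE.
  by case: (arg_minnP (fun t : 'I_n => nat_of_ord t) ht) => m hm minm; exists m.
have card4 (x y z w : V) : (#|[set x; y; z; w]| <= 4)%N.
  apply: leq_trans (leq_card_setU _ _) _; rewrite cards1 addn1 ltnS.
  apply: leq_trans (leq_card_setU _ _) _; rewrite cards1 addn1 ltnS cards2.
  by case: (_ == _).
pose p b := gen n b m; pose q b := gen n b m.-1.
have cases g : g \in gens n -> h + g \in gens n ->
    (exists b, g = p b) \/ (exists b, h + g = p b) \/ (h = p false /\ exists b, g = q b).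
  case/imsetP=> -[b j] _ /= def_g /imsetP[[c k] _ /= def_hg].
  have hE t : h t = gen n c k t (+) gen n b j t.
    by rewrite -cubeDE -def_hg def_g cubeDK.
  have hj := hE j; have hk := hE k; rewrite !ffunE !eqxx /= in hj hk.
  have hmE := hE m; rewrite !ffunE /= hm in hmE.
  have [ltjk|ltkj|eqjk] := ltngtP j k.
  - left; exists b; rewrite def_g; congr gen.
    by have := minm j; rewrite hj; lia.
  - right; left; exists c; rewrite def_hg; congr gen.
    by have := minm k; rewrite hk; lia.
  - right; right; have def_m : m = j.+1 :> nat by move: hmE; rewrite eqjk; lia.
    split; last by exists b; rewrite def_g /q def_m.
    apply/ffunP=> t; rewrite hE !ffunE; rewrite eqjk in def_m *; rewrite def_m.
    move: hmE; rewrite def_m; lia.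
have [def_h|ndef_h] := eqVneq h (p false).
  apply: leq_trans (card4 (p true) (h + p true) (q false) (q true)).
  apply: subset_leq_card; apply/subsetP=> g; rewrite inE => /andP[gg gh].
  have p0 : 0 \notin gens n.
    apply/imsetP=> -[[b j] _ /= /ffunP/(_ j)]; by rewrite !ffunE eqxx.
  rewrite !inE -!orbA; case: (cases g gg gh) => [[[] eqg]|[[[] eqg]|[_ [[] eqg]]]].
  - by rewrite eqg eqxx.
  - by move: gh; rewrite eqg -def_h cubeDD (negbTE p0).
  - by rewrite -eqg cubeKD eqxx orbT.
  - by move: gg; rewrite -(cubeKD h g) eqg -def_h cubeDD (negbTE p0).
  - by rewrite eqg eqxx !orbT.
  - by rewrite eqg eqxx !orbT.
apply: leq_trans (card4 (p true) (h + p true) (p false) (h + p false)).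
apply: subset_leq_card; apply/subsetP=> g; rewrite inE => /andP[gg gh].
rewrite !inE -!orbA; case: (cases g gg gh) => [[[] eqg]|[[[] eqg]|[def_h _]]].
- by rewrite eqg eqxx.
- by rewrite eqg eqxx !orbT.
- by rewrite -eqg cubeKD eqxx orbT.
- by rewrite -eqg cubeKD eqxx !orbT.
- by rewrite def_h eqxx in ndef_h.
Qed.

End Gens.

(** * Disjoint paths in a half of the cube *)

Lemma flatten_map_uniq (S T : eqType) (F : S -> seq T) (s : seq S) :
  uniq s -> (forall a, a \in s -> uniq (F a)) ->
  (forall a b v, a \in s -> b \in s -> v \in F a -> v \in F b -> a = b) ->
  uniq (flatten [seq F a | a <- s]).
Proof.
elim: s => //= a s IH /andP[nas us] uF dis; rewrite cat_uniq uF ?mem_head //=.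
rewrite IH //; first 1 last.
- by move=> b bs; apply: uF; rewrite inE bs orbT.
- by move=> b c v bs cs; apply: dis; rewrite inE ?bs ?cs orbT.
rewrite andbT; apply/hasPn=> v /flatten_mapP[b bs vb]; apply: contra nas => va.
by rewrite (dis a b v) ?mem_head // inE bs orbT.
Qed.

Lemma perm_flatten_cons (T : eqType) (f : T -> seq T) (s : seq T) :
  perm_eq (flatten [seq v :: f v | v <- s]) (s ++ flatten [seq f v | v <- s]).
Proof.
apply/permP=> P; elim: s => //= v s IH; rewrite !count_cat IH count_cat; lia.
Qed.

Section Half.
Local Open Scope ring_scope.
Variables (n : nat) (i : 'I_n).
Hypotheses (i_gt0 : (0 < i)%N) (i_lt : (i.+1 < n)%N).
Local Notation V := {ffun 'I_n -> bool}.
Implicit Types (u v w x y z g a b : V) (X S : {set V}).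

Definition hcube : rel V := [rel u v | (u + v \in gens n) && ~~ (u + v) i].

Lemma half_sym : symmetric hcube.
Proof. by move=> u v; rewrite /hcube /= addrC. Qed.

Lemma half_cadj : hcube =2 cadj [set~ i].
Proof.
move=> u v; rewrite /hcube /cadj /=; congr (_ && _); apply/idP/suppS=> [nui t|-> //].
  by rewrite !inE negbK => /eqP->; apply/negbTE.
by rewrite !inE eqxx.
Qed.

Lemma halfE u v : hcube u v -> v i = u i.
Proof. by case/andP=> _; rewrite cubeDE; case: (u i) (v i) => -[]. Qed.

Lemma path_halfE u q v : path hcube u q -> v \in u :: q -> v i = u i.
Proof.
elim: q u => [|w q IH] u /=; first by rewrite inE => _ /eqP->.
case/andP=> uw wq; rewrite inE => /predU1P[->//|vq].
by rewrite (IH w) // (halfE uw).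
Qed.

Lemma half_irr u : hcube u u = false.
Proof.
rewrite /hcube /= cubeDD; apply/negbTE; rewrite negb_and; apply/orP; left.
by apply/imsetP=> -[[b j] _ /= /ffunP/(_ j)]; rewrite !ffunE eqxx.
Qed.

Lemma half_connected X u v : (#|X| < 2 * n - 4)%N -> u \notin X -> v \notin X ->
  u i = v i -> connect (avoiding hcube X) u v.
Proof.
move=> ltX uX vX uv.
have [|||cI _] := @conn_punctured n i 0 n.-1; try lia.
have eqI : punctured n i 0 n.-1 = [set~ i] :> {set 'I_n}.
  by apply/setP=> t; rewrite !inE -val_eqE /=; have := ltn_ord t; lia.
rewrite eqI in cI; rewrite (eq_connect (e' := avoiding (cadj [set~ i]) X)).
  apply: cI => //; first by lia.
  by apply/suppS=> t; rewrite !inE negbK => /eqP->; rewrite cubeDE uv addbb.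
by move=> a b; rewrite /avoiding /= half_cadj.
Qed.

Definition nbr x : {set V} := [set a | hcube x a].

Lemma card_nbr x : #|nbr x| = (2 * n - 4)%N.
Proof.
rewrite -(card_half_gens i_gt0 i_lt) -[RHS](card_imset _ (addrI x)); apply: eq_card => a.
rewrite !inE; apply/idP/imsetP=> [xa|[g]]; first by exists (x + a); rewrite ?inE ?cubeKD.
by rewrite inE /hcube /= => Pg ->; rewrite cubeKD.
Qed.

Lemma card_common_nbr x y : x != y -> (#|nbr x :&: nbr y| <= 4)%N.
Proof.
move=> nxy; have nz : x + y != 0 by rewrite cubeD_eq0.
apply: leq_trans (card_common_gens nz); rewrite -(card_imset _ (addrI x)).
apply: subset_leq_card; apply/subsetP=> _ /imsetP[a + ->].
rewrite !inE => /andP[/andP[xa _] /andP[ya _]]; rewrite xa [x + y]addrC -addrA.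
by rewrite [x + (x + a)]cubeKD.
Qed.

(** The path stops just before [y], because the linkages below end at the neighbours of a terminal.
    It serves to refute separators that are too small. *)
Lemma escape X u y : (#|X| < 2 * n - 4)%N -> u \notin X -> y \notin X ->
  u i = y i -> u != y ->
  exists q, [/\ path hcube u q, uniq (u :: q), last u q \in nbr y,
    y \notin u :: q & all [predC X] (u :: q)].
Proof.
move=> ltX uX yX uy nuy; have /connectP[p] := half_connected ltX uX yX uy.
case/shortenP=> p'; case/lastP: p' => [|q w] /=.
  by move=> _ _ _ eqy; rewrite eqy eqxx in nuy.
rewrite last_rcons path_avoiding all_rcons rcons_path.
move=> /and3P[/andP[hq hw] _ aq] uq _ def_w; rewrite -def_w in hw uq.
exists q; rewrite hq aq /= uX inE half_sym hw; move: uq.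
by rewrite mem_rcons rcons_uniq inE negb_or => /andP[/andP[_ ->] /andP[yq ->]];
  rewrite inE negb_or eq_sym nuy yq.
Qed.

Lemma linkage_full (e : rel V) (A B : {set V}) :
  (forall S, separates e A B S -> (#|A| <= #|S|)%N) ->
  exists2 p, linkage e A B p & forall a, a \in A -> uniq (a :: p a).
Proof.
move=> sepA; have [A' [p [sA cA lp]]] := menger sepA.
have eqA : A' = A by apply/eqP; rewrite eqEcard sA cA leqnn.
by rewrite eqA in lp; apply: linkage_uniq lp.
Qed.

(** Menger's theorem is applied with the neighbours of [z] as targets and [z] deleted, so that the
    paths remain disjoint until each is extended by [z]. A smaller separator would miss some [u] in
    [U], from which [escape] leads past it. *)
Lemma fan z (U : {set V}) : (#|U| <= 2 * n - 4)%N -> z \notin U ->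
  (forall u, u \in U -> u i = z i) ->
  exists2 q, linkage (avoiding hcube [set z]) U (nbr z) q & forall u, u \in U -> uniq (u :: q u).
Proof.
move=> leU zU iU; apply: linkage_full => S sS; rewrite leqNgt; apply/negP=> ltS.
have /subsetPn[u uU uS] : ~~ (U \subset S).
  by apply/negP=> /subset_leq_card; rewrite leqNgt ltS.
have [|||||q [hq uq lq zq aq]] := @escape (S :\ z) u z.
- by apply: leq_trans leU; apply: leq_ltn_trans ltS; apply/subset_leq_card/subD1set.
- by rewrite !inE (negbTE uS) andbF.
- by rewrite !inE eqxx.
- exact: iU.
- by apply: contraNneq zU => <-.
have /hasP[w wq /= Sw] : has (mem S) (u :: q).
  apply: sS => //; rewrite path_avoiding hq; apply/allP=> w wq /=.
  by rewrite inE; apply: contraNneq zq => <-; rewrite inE wq orbT.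
have := allP aq w wq; rewrite /= !inE Sw andbT negbK => /eqP def_w.
by rewrite -def_w wq in zq.
Qed.

Lemma two_terminal x y : x != y -> x i = y i ->
  exists2 p, linkage (avoiding hcube [set x; y]) (nbr x :\ y) (nbr y :\ x) p
           & forall a, a \in nbr x :\ y -> uniq (a :: p a).
Proof.
move=> nxy xy; apply: linkage_full => S sS; rewrite leqNgt; apply/negP=> ltS.
have cA := cardsD1 y (nbr x); rewrite card_nbr inE in cA.
(* If x and y are adjacent, the linkage has size 2n - 5, so [x] can be removed together with the
   separator and the escape starts at a neighbour of [x]. Otherwise the size is 2n - 4 and leaves no
   room for this; the escape starts at [x] itself and its next vertex lies in the source set. *)
have [hxy|nhxy] := boolP (hcube x y); rewrite ?hxy ?(negbTE nhxy) in cA.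
  have /subsetPn[a aA aS] : ~~ (nbr x :\ y \subset S).
    by apply/negP=> /subset_leq_card; rewrite leqNgt ltS.
  have /andP[nay hxa] : (a != y) && hcube x a by move: aA; rewrite !inE.
  have nax : a != x by apply: contraTneq hxa => ->; rewrite half_irr.
  have [|||||q [hq uq lq yq aq]] := @escape (x |: (S :\ y)) a y.
  - rewrite cardsU1 cA; apply: leq_ltn_trans (leq_add (leq_b1 _) (subset_leq_card (subD1set S y))) _.
    by rewrite ltn_add2l.
  - by rewrite !inE (negbTE nax) (negbTE aS) andbF.
  - by rewrite !inE eqxx eq_sym (negbTE nxy).
  - by rewrite (halfE hxa).
  - by [].
  have nxq w : w \in a :: q -> w != x.
    by move/(allP aq); rewrite /= !inE negb_or => /andP[].
  have nyq w : w \in a :: q -> w != y by move=> wq; apply: contraNneq yq => <-.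
  have /hasP[w wq /= Sw] : has (mem S) (a :: q).
    apply: sS => //; last by rewrite !inE nxq ?mem_last //; rewrite inE in lq.
    rewrite path_avoiding hq; apply/allP=> w wq /=.
    have wq' : w \in a :: q by rewrite inE wq orbT.
    by rewrite !inE negb_or nxq // nyq.
  by have := allP aq w wq; rewrite /= !inE Sw (negbTE (nyq w wq)) orbT.
have [|||||q [hq uq lq yq aq]] := @escape (S :\ y :\ x) x y.
- rewrite cA add0n; apply: leq_ltn_trans ltS.
  by apply: leq_trans (subset_leq_card (subD1set _ _)) (subset_leq_card (subD1set _ _)).
- by rewrite !inE eqxx.
- by rewrite !inE eqxx andbF.
- by [].
- by [].
case: q hq uq lq yq aq => [|a q] /=; first by rewrite inE half_sym (negbTE nhxy).
case/andP=> hxa hq; rewrite inE negb_or => /andP[/andP[nxa xq] uq] lq.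
rewrite 2!inE !negb_or => /and3P[_ nya yq] /andP[_ aq].
have nq w : w \in a :: q -> (w != x) && (w != y).
  by rewrite inE => /predU1P[->|wq]; [rewrite ![a == _]eq_sym nxa |
    apply/andP; split; apply: contraTneq wq => ->].
have /hasP[w wq /= Sw] : has (mem S) (a :: q).
  apply: sS => //.
  - by rewrite !inE hxa eq_sym nya.
  - rewrite path_avoiding hq; apply/allP=> w wq /=.
    have wq' : w \in a :: q by rewrite inE wq orbT.
    by rewrite !inE negb_or nq.
  - by rewrite inE lq andbT !inE; case/andP: (nq _ (mem_last a q)).
have := @allP _ [predC S :\ y :\ x] (a :: q) aq w wq.
by case/andP: (nq w wq) => nwx nwy; rewrite /= !inE nwx nwy Sw.
Qed.

(* F consists of the interiors of x - y paths; U and W are the neighbours of x and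
   y at which the remaining strands leave the half.  The vertices x + g and y + g
   must lie on F because the edges that leave x and y for the other half directly
   end at their twins there. *)
Definition half_splitting x y g k (F : seq (seq V)) (U W : seq V) :=
  [/\ size F = (2 * k)%N, size U = (2 * k - 4)%N & size W = (2 * k - 4)%N] /\
  [/\ forall f, f \in F -> path hcube x (rcons f y), (count (@nilp V) F <= 1)%N,
      forall u, u \in U -> hcube x u & forall w, w \in W -> hcube y w] /\
  [/\ uniq (x :: y :: flatten F ++ U ++ W),
      forall v, v \in flatten F ++ U ++ W -> v i = x i,
      x + g \in flatten F & y + g \in flatten F].

(** The strands starting in [Q] are cut: only their first and last vertices survive, so they need
    not be paths. If x and y are adjacent, their edge joins the kept strands as the empty segment,
    and in both cases 4k - 4 - (2k - 4) = 2k are kept. *)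
Lemma split_paths (A Q : {set V}) (p : V -> seq V) x y g k :
  (#|A| + hcube x y = 4 * k - 4)%N -> (2 <= k)%N -> Q \subset A -> #|Q| = (2 * k - 4)%N ->
  x != y ->
  (forall a, a \in A -> [/\ uniq (a :: p a), hcube x a & hcube y (last a (p a))]) ->
  (forall a v, a \in A -> v \in a :: p a -> [/\ v != x, v != y & v i = x i]) ->
  (forall a b v, a \in A -> b \in A -> v \in a :: p a -> v \in b :: p b -> a = b) ->
  (forall a, a \in A :\: Q -> path hcube a (p a)) ->
  (forall a, a \in Q -> last a (p a) != a) ->
  (exists2 a, a \in A :\: Q & x + g \in a :: p a) ->
  (exists2 a, a \in A :\: Q & y + g \in a :: p a) ->
  exists F U W, half_splitting x y g k F U W.
Proof.
move=> cA k2 QA cQ nxy pA pxy pD ppath nshort [ax axQ xg] [ay ayQ yg].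
pose t a := last a (p a).
exists ((if hcube x y then [:: [::]] else [::]) ++ [seq a :: p a | a <- enum (A :\: Q)]).
exists (enum Q), [seq t a | a <- enum Q]; rewrite /half_splitting flatten_cat.
have -> : flatten (if hcube x y then [:: [::]] else [::]) = [::] :> seq V by case: ifP.
have QinA a : a \in Q -> a \in A by move/(subsetP QA).
have AQinA a : a \in A :\: Q -> a \in A by rewrite inE => /andP[].
have inF v a : a \in A :\: Q -> v \in a :: p a ->
    v \in flatten [seq a :: p a | a <- enum (A :\: Q)].
  by move=> aQ va; apply/flatten_mapP; exists a; rewrite ?mem_enum.
split; [split; rewrite ?size_map -?cardE // | split; [split | rewrite /=; split]].
- rewrite size_cat size_map -cardE cardsD (setIidPr QA) cQ.
  by move: cA; case: (hcube x y); rewrite /= ?addn1 ?addn0; move: #|A| => m; lia.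
- move=> f; rewrite mem_cat; case/orP=> [|/mapP[a]].
    by case: (boolP (hcube x y)) => // hxy; rewrite inE => /eqP->; rewrite /= hxy.
  rewrite mem_enum => aQ ->; have [_ xa yt] := pA a (AQinA a aQ).
  by rewrite /= rcons_path xa ppath // half_sym.
- rewrite count_cat; have -> : count (@nilp V) [seq a :: p a | a <- enum (A :\: Q)] = 0%N.
    by apply/eqP; rewrite -leqn0 leqNgt -has_count; apply/hasPn=> _ /mapP[a _ ->].
  by rewrite addn0; case: ifP.
- by move=> u; rewrite mem_enum => /QinA/pA[].
- by move=> w /mapP[a]; rewrite mem_enum => /QinA/pA[_ _ ya] ->.
(* What is left of each strand after cutting. A cut strand contributes two distinct vertices because
   [nshort] excludes equal ends. *)
- pose F' a := if a \in Q then [:: a; t a] else a :: p a.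
  have F'p a v : v \in F' a -> v \in a :: p a.
    rewrite /F'; case: ifP => // _; rewrite !inE => /orP[/eqP->|/eqP->]; first by rewrite eqxx.
    by rewrite -in_cons mem_last.
  pose s := enum (A :\: Q) ++ enum Q.
  have sA a : a \in s -> a \in A by rewrite mem_cat !mem_enum => /orP[/AQinA|/QinA].
  have us : uniq s.
    rewrite cat_uniq !enum_uniq andbT; apply/hasPn=> a; rewrite mem_enum => aQ /=.
    by rewrite mem_enum inE aQ.
  have uF' : uniq (flatten [seq F' a | a <- s]).
    apply: flatten_map_uniq => // [a as_|a b v as_ bs /F'p va /F'p vb].
      rewrite /F'; case: ifP => [aQ|_]; last by case: (pA a (sA a as_)).
      by rewrite /= inE eq_sym nshort.
    by apply: (pD a b v) => //; apply: sA.
  have sF v : v \in flatten [seq F' a | a <- s] -> [/\ v != x, v != y & v i = x i].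
    by case/flatten_mapP=> a /sA aA /F'p va; apply: (pxy a).
  have perm_s : perm_eq (flatten [seq a :: p a | a <- enum (A :\: Q)] ++
      enum Q ++ [seq t a | a <- enum Q])
      (flatten [seq F' a | a <- s]).
    rewrite map_cat flatten_cat; apply: perm_cat.
      rewrite (eq_in_map _ F' (enum (A :\: Q))).1 // => a; rewrite mem_enum inE => /andP[aQ _].
      by rewrite /F' (negbTE aQ).
    rewrite -(eq_in_map (fun a => a :: [:: t a]) F' (enum Q)).1; last first.
      by move=> a; rewrite mem_enum /F' => ->.
    rewrite perm_sym; apply: (perm_trans (perm_flatten_cons _ _)).
    by rewrite perm_cat2l; elim: (enum Q) => //= a s' IH; rewrite perm_cons.
  rewrite inE (negbTE nxy) /= (perm_mem perm_s x) (perm_mem perm_s y) (perm_uniq perm_s) uF' andbT.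
  by apply/andP; split; apply/negP=> /sF[]; rewrite ?eqxx.
- move=> v; rewrite !mem_cat => /or3P[/flatten_mapP[a]|vQ|/mapP[a]].
  + by rewrite mem_enum => /AQinA aA va; case: (pxy a v aA va).
  + by move: vQ; rewrite mem_enum => /QinA aA; case: (pxy v v aA (mem_head _ _)).
  + by rewrite mem_enum => /QinA aA ->; case: (pxy a _ aA (mem_last a (p a))).
- exact: inF xg.
- exact: inF yg.
Qed.

Lemma subset_card (T : finType) (A : {set T}) m : (m <= #|A|)%N ->
  exists2 Q : {set T}, Q \subset A & #|Q| = m.
Proof.
case/card_geqP=> s [us <- sA]; exists [set x in s]; last by rewrite cardsE (card_uniqP us).
by apply/subsetP=> x; rewrite inE => /sA.
Qed.

Lemma half_split x y g k : n = (2 * k)%N -> (2 <= k)%N -> x != y -> x i = y i ->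
  g \in gens n -> ~~ g i -> y != x + g ->
  exists F U W, half_splitting x y g k F U W.
Proof.
move=> n2k k2 nxy xy gg gi nyxg; have nyx : y != x by rewrite eq_sym.
have [p lp up] := two_terminal nxy xy.
set A := nbr x :\ y in lp up; set B := nbr y :\ x in lp.
have [pe pB pD] := lp; pose t a := last a (p a).
have n4 : (2 * n - 4 = 4 * k - 4)%N by rewrite n2k; lia.
have cA : (#|A| + hcube x y = 4 * k - 4)%N.
  by have := cardsD1 y (nbr x); rewrite card_nbr inE -/A n4 => ->; rewrite addnC.
have cB : (#|B| + hcube x y = 4 * k - 4)%N.
  by have := cardsD1 x (nbr y); rewrite card_nbr inE -/B half_sym n4 => ->; rewrite addnC.
have cAB : #|B| = #|A| by apply/eqP; rewrite -(eqn_add2r (hcube x y)) cA cB.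
have Anbr a : a \in A -> hcube x a && (a != y) by rewrite !inE andbC.
have tnbr a : a \in A -> hcube y (t a) && (t a != x) by move/pB; rewrite !inE andbC.
have pxy a v : a \in A -> v \in a :: p a -> [/\ v != x, v != y & v i = x i].
  move=> aA va; have := pe a aA; rewrite path_avoiding => /andP[ha na].
  have /andP[xa nay] := Anbr a aA.
  have vi : v i = x i.
    by rewrite -(halfE xa); apply: path_halfE ha va.
  move: va; rewrite inE => /predU1P[va|/(allP na)]; last first.
    by rewrite /= !inE negb_or => /andP[].
  split=> //; rewrite va //; by apply: contraTneq xa => ->; rewrite half_irr.
have t_inj : {in A &, injective t} := linkage_last_inj lp.
have hg u : hcube u (u + g) by rewrite /hcube /= cubeKD gg.
have a1A : x + g \in A by rewrite !inE hg andbT eq_sym.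
have b1B : y + g \in B.
  by rewrite !inE hg andbT; apply: contraNneq nyxg => <-; rewrite cubeDK.
have [a2 a2A ta2] : exists2 a, a \in A & t a = y + g.
  by apply: (linkage_onto lp) b1B; rewrite cAB.
set a1 : V := x + g in a1A; set b1 : V := y + g in b1B ta2.
have pA a : a \in A -> [/\ uniq (a :: p a), hcube x a & hcube y (t a)].
  by move=> aA; split; [exact: up | case/andP: (Anbr a aA) | case/andP: (tnbr a aA)].
have pathA a : a \in A -> path hcube a (p a).
  by move/pe; rewrite path_avoiding => /andP[].
pose Sh : {set V} := [set a in A | t a == a].
have ShP a : (a \in Sh) = (a \in A) && (t a == a) by rewrite in_set.
have cSh : (#|Sh| <= 4)%N.
  apply: leq_trans (card_common_nbr nxy); apply: subset_leq_card; apply/subsetP=> a.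
  rewrite inE => /andP[aA /eqP ta]; rewrite !inE -{2}ta.
  by case/andP: (Anbr a aA) => -> _; case/andP: (tnbr a aA).
(* First vertices of the strands that may not be cut: the one starting at x + g, the one ending at y
   + g, and those in [Sh], whose single end point is a common neighbour of x and y. *)
pose Z : {set V} := [set a1; a2] :|: Sh.
have cZ : (#|Z| <= 6)%N.
  apply: leq_trans (leq_card_setU _ _) _; apply: (@leq_add _ _ 2%N 4%N) => //.
  by rewrite cards2 ltnS leq_b1.
have ZA : Z \subset A.
  by rewrite !subUset !sub1set a1A a2A; apply/subsetP=> a; rewrite in_set => /andP[].
have AZP a : a \in A :\: Z -> [/\ a \in A, a != a1, a != a2 & t a != a].
  rewrite in_setD /Z in_setU in_set2 in_set => /andP[+ aA].
  by rewrite aA /= !negb_or => /andP[/andP[-> ->] ->].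
have cAZ : #|A :\: Z| = (#|A| - #|Z|)%N by rewrite cardsD (setIidPr ZA).
(* For k = 2 nothing has to be cut, since 2k - 4 = 0. *)
have [k3|k3] := leqP k 2.
  have kE : k = 2 by apply/eqP; rewrite eqn_leq k2 k3.
  apply: (@split_paths A set0 p x y g k) => //.
  - exact: sub0set.
  - by rewrite cards0 kE.
  - by move=> a; rewrite setD0; apply: pathA.
  - by move=> a; rewrite inE.
  - by exists a1; rewrite ?setD0 ?mem_head.
  - by exists a2; rewrite ?setD0 // -/b1 -ta2 mem_last.
have finish (Q : {set V}) : Q \subset A :\: Z -> #|Q| = (2 * k - 4)%N ->
    exists F U W, half_splitting x y g k F U W.
  move=> QAZ cQ; have QZ a : a \in Q -> [/\ a \in A, a != a1, a != a2 & t a != a].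
    by move/(subsetP QAZ)/AZP.
  have QA : Q \subset A by apply: subset_trans QAZ (subsetDl _ _).
  apply: (@split_paths A Q p x y g k) => //.
  - by move=> a; rewrite inE => /andP[_]; apply: pathA.
  - by move=> a /QZ[].
  - exists a1; rewrite ?mem_head // inE a1A andbT; apply/negP=> /QZ[_]; by rewrite eqxx.
  - exists a2; last by rewrite -/b1 -ta2 mem_last.
    by rewrite inE a2A andbT; apply/negP=> /QZ[_ _]; rewrite eqxx.
(* There are 4k - 4 strands, counting a possible edge x - y, and 2k - 4 must be cut. Six exceptions
   are affordable because k >= 3. *)
have [leZ|gtZ] := leqP (#|Z| + hcube x y) 6.
  have arith (m s h : nat) : (m + h = 4 * k - 4 -> s + h <= 6 -> 2 * k - 4 <= m - s)%N.
    by clear -k3; lia.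
  have [|Q QAZ cQ] := @subset_card _ (A :\: Z) (2 * k - 4); last exact: finish QAZ cQ.
  by rewrite cAZ; apply: arith cA leZ.
have hxy : hcube x y.
  by apply: contraLR gtZ => /negbTE->; rewrite -leqNgt addn0.
have arith3 (s c b : nat) : (6 < s.+1 -> c <= 4 -> b <= 1 -> s <= b + c -> False)%N.
  by clear; lia.
(* Now [Z] has at least six elements and [Sh] at most four, so [a1] and [a2] are distinct and
   neither of their strands is short. *)
have Z6 a : ~~ (Z \subset a |: Sh).
  apply/negP=> /subset_leq_card; rewrite cardsU1; have := leq_b1 (a \notin Sh).
  by move: gtZ cSh; rewrite hxy addn1; exact: arith3.
have n12 : a1 != a2.
  by apply: contra (Z6 a1) => /eqP eq12; rewrite /Z -eq12 setUid.
have ns1 : t a1 != a1.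
  apply: contra (Z6 a2) => s1; rewrite !subUset subsetUl subsetUr !sub1set !andbT.
  by rewrite in_setU ShP a1A s1 orbT.
have ns2 : t a2 != a2.
  apply: contra (Z6 a1) => s2; rewrite !subUset subsetUl subsetUr !sub1set !andbT.
  by rewrite in_setU ShP a2A s2 orbT.
(* Here x and y are adjacent, and x + g and y + g are on different paths of the
   linkage.  Reroute: [x + g; y + g] becomes a path, and the two leftover pieces
   a2 .. and .. t a1 form a strand that need not be connected as it is cut. *)
have arith (m s : nat) : (s <= 6 -> m.+1 = 4 * k - 4 -> 2 * k - 5 <= m - s)%N.
  by clear -k3; lia.
(* One of the 2k - 4 strands to be cut will be the broken one starting at [a2], so 2k - 5 more are
   chosen. *)
have [|Q0 Q0AZ cQ0] := @subset_card _ (A :\: Z) (2 * k - 5).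
  by rewrite cAZ; apply: (arith _ _ cZ); rewrite -cA hxy addn1.
have Q0Z a : a \in Q0 -> [/\ a \in A, a != a1, a != a2 & t a != a].
  by move/(subsetP Q0AZ)/AZP.
have a2Q0 : a2 \notin Q0 by apply/negP=> /Q0Z[_ _]; rewrite eqxx.
pose p' a := if a == a1 then [:: b1] else if a == a2 then [:: t a1] else p a.
have p'1 : p' a1 = [:: b1] by rewrite /p' eqxx.
have p'2 : p' a2 = [:: t a1] by rewrite /p' eq_sym (negbTE n12) eqxx.
have p'3 a : a != a1 -> a != a2 -> p' a = p a by rewrite /p' => /negbTE-> /negbTE->.
have t12 : t a1 != b1 by rewrite -ta2; apply: contraNneq n12 => /t_inj->.
have memt a : t a \in a :: p a by apply: mem_last.
have n_a2_ta1 : a2 != t a1.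
  by apply: contraNneq n12 => eqa; rewrite (pD a1 a2 a2) // ?mem_head // eqa memt.
have n_a1_b1 : a1 != b1 by rewrite (inj_eq (addIr g)).
have n_a2_b1 : a2 != b1 by rewrite -ta2 eq_sym.
have casesA a : a \in A -> [\/ a = a1, a = a2 | [/\ a != a1, a != a2 & p' a = p a]].
  move=> aA; have [->|n1] := eqVneq a a1; first by constructor 1.
  have [->|n2] := eqVneq a a2; first by constructor 2.
  by constructor 3; rewrite p'3.
have own a v : a \in A -> v \in a :: p' a ->
    exists2 b, b \in A /\ v \in b :: p b & (b == a) || ((a \in [:: a1; a2]) && (b \in [:: a1; a2])).
  move=> aA; case: (casesA a aA) => [->|->|[n1 n2 ->]].
  - rewrite p'1 !inE => /orP[/eqP->|/eqP->]; first by exists a1; rewrite ?eqxx // mem_head.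
    by exists a2; [split; rewrite // -ta2 | rewrite !inE !eqxx !orbT].
  - rewrite p'2 !inE => /orP[/eqP->|/eqP->]; first by exists a2; rewrite ?eqxx // mem_head.
    by exists a1; [split | rewrite !inE !eqxx !orbT].
  - by move=> va; exists a; rewrite ?eqxx.
apply: (@split_paths A (a2 |: Q0) p' x y g k) => //.
- by rewrite subUset sub1set a2A; apply: subset_trans Q0AZ (subsetDl _ _).
- by rewrite cardsU1 a2Q0 cQ0; clear -k3; rewrite /=; lia.
- move=> a aA; have [ua xa ya] := pA a aA; split=> //.
    case: (casesA a aA) => [->|->|[_ _ ->]] //; first by rewrite p'1 /= inE n_a1_b1.
    by rewrite p'2 /= inE n_a2_ta1.
  case: (casesA a aA) => [->|->|[_ _ ->]] //; first by rewrite p'1 hg.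
  by rewrite p'2; case/andP: (tnbr a1 a1A).
- by move=> a v aA va; have [b [bA vb] _] := own a v aA va; apply: pxy vb.
- move=> a b v aA bA va vb; have [c [cAA vc] ca] := own a v aA va.
  have [c' [cA' vc'] cb] := own b v bA vb; have eqc := pD c c' v cAA cA' vc vc'.
  rewrite -eqc in cb; have dis12 w : w \in a1 :: p' a1 -> w \in a2 :: p' a2 -> False.
    rewrite p'1 p'2 !inE => /orP[]/eqP-> /orP[]; apply/negP => //; first by rewrite eq_sym.
      by rewrite eq_sym.
    by rewrite eq_sym.
  have [a12|na12] := boolP (a \in [:: a1; a2]); have [b12|nb12] := boolP (b \in [:: a1; a2]).
  + move: a12 b12 va vb; rewrite !inE.
    case/orP=> /eqP->; case/orP=> /eqP-> // va vb; [case: (dis12 v va vb) | case: (dis12 v vb va)].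
  + rewrite (negbTE nb12) orbF in cb; rewrite (eqP cb) (negbTE nb12) andbF orbF in ca.
    by rewrite (eqP ca).
  + rewrite (negbTE na12) orbF in ca; rewrite (eqP ca) (negbTE na12) andbF orbF in cb.
    by rewrite (eqP cb).
  + by rewrite (negbTE na12) orbF in ca; rewrite (negbTE nb12) orbF in cb; rewrite -(eqP ca) (eqP cb).
- move=> a; rewrite in_setD in_setU1 negb_or => /andP[/andP[n2 _] aA].
  case: (casesA a aA) => [->|eqa|[_ _ ->]]; last exact: pathA.
    by rewrite p'1 /hcube /= andbT addrACA cubeDD addr0.
  by rewrite eqa eqxx in n2.
- move=> a; rewrite in_setU1 => /predU1P[->|/Q0Z[aA n1 n2 ns]]; last by rewrite p'3.
  by rewrite p'2 /= eq_sym.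
- exists a1; rewrite ?mem_head // in_setD a1A andbT in_setU1 negb_or n12.
  by apply/negP=> /Q0Z[_]; rewrite eqxx.
- exists a1; last by rewrite p'1 !inE eqxx orbT.
  rewrite in_setD a1A andbT in_setU1 negb_or n12.
  by apply/negP=> /Q0Z[_]; rewrite eqxx.
Qed.

End Half.

(** * Segments for a triple split 2 + 1 *)

Section Segments.
Local Open Scope ring_scope.
Variables (n : nat) (i : 'I_n).
Hypotheses (i_gt0 : (0 < i)%N) (i_lt : (i.+1 < n)%N).
Local Notation V := {ffun 'I_n -> bool}.

Definition cube : rel V := [rel u v | u + v \in gens n].

Lemma half_cube u v : hcube i u v -> cube u v.
Proof. by case/andP. Qed.

Lemma cube_sym : symmetric cube.
Proof. by move=> u v; rewrite /cube /= addrC. Qed.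

Lemma cube_segments (x y z : V) k : n = (2 * k)%N -> (2 <= k)%N ->
  x != y -> x i = y i -> z i != x i ->
  exists Sxy Syz Sxz : seq (seq V),
    [/\ forall s, s \in Sxy -> path cube x (rcons s y),
        forall s, s \in Syz -> path cube y (rcons s z)
      & forall s, s \in Sxz -> path cube x (rcons s z)] /\
    [/\ size Sxy = (k + k)%N, size Syz = (k + (k - 2))%N & size Sxz = (k + (k - 2))%N] /\
    [/\ (count (@nilp V) Sxy <= 1)%N, (count (@nilp V) Syz <= 1)%N
      & (count (@nilp V) Sxz <= 1)%N] /\
    uniq (x :: y :: z :: flatten (Sxy ++ Syz ++ Sxz)).
Proof.
move=> n2k k2 nxy xy zx; have n4 : (2 * n - 4 = 4 * k - 4)%N by rewrite n2k; lia.
have i1n : (i.-1 < n)%N by lia.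
pose d := gen n false i; have gd : d \in gens n by rewrite gen_in.
have di : d i by rewrite ffunE eqxx.
(* The direct crossings are along [d] and [g + d]. Take g = d_(i-1), or g = d_(i+1) if y = x +
   d_(i-1); then g + d is d_(i-1) + d_i or d_i + d_(i+1). *)
have [g [gg gi gdg yg]] : exists g : V, [/\ g \in gens n, ~~ g i, g + d \in gens n & y != x + g].
  have gP j : (j < n)%N -> (j = i.-1 \/ j = i.+1)%N -> gen n false j + d = gen n true (minn i j) ->
      y != x + gen n false j ->
      exists g : V, [/\ g \in gens n, ~~ g i, g + d \in gens n & y != x + g].
    move=> ltj ij eqg yj; exists (gen n false j); split=> //; first exact: gen_in.
      by rewrite ffunE orbF; move: i_gt0; lia.
    by rewrite eqg gen_in //; lia.
  have [eqy|ny] := eqVneq y (x + gen n false i.-1); last first.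
    apply: (gP i.-1) => //; first by left.
    by apply/ffunP=> t; rewrite cubeDE !ffunE; apply/idP/idP; move: i_gt0; clear; rewrite /= !orbF; lia.
  apply: (gP i.+1) => //; first by right.
    by apply/ffunP=> t; rewrite cubeDE !ffunE; apply/idP/idP; move: i_gt0; clear; rewrite /= !orbF; lia.
  rewrite eqy (inj_eq (addrI x)); apply/eqP=> /ffunP/(_ (Ordinal i1n)).
  by rewrite !ffunE /= eqxx /=; lia.
have gn0 : g != 0.
  apply: contraNneq yg => g0; move: gdg gg; rewrite g0 => _.
  by case/imsetP=> -[b j] _ /= /ffunP/(_ j); rewrite !ffunE eqxx.
have [F [U [W [[szF szU szW] [[pF nF pU pW] [uL iL xgF ygF]]]]]] :=
  half_split i_gt0 i_lt n2k k2 nxy xy gg gi yg.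
pose L := U ++ W ++ [:: x; x + g; y; y + g].
have uniqL : uniq L.
  move: uL; rewrite /= !inE negb_or => /and3P[/andP[_ xL] yL].
  rewrite !mem_cat !negb_or in xL yL; rewrite cat_uniq => /and3P[uF /hasPn disF uUW].
  have nUW v : v \in flatten F -> v \notin U ++ W.
    by move=> vF; apply/negP=> /disF; rewrite /= vF.
  rewrite /L catA cat_uniq uUW /=; apply/andP; split.
    rewrite orbF !negb_or (nUW _ xgF) (nUW _ ygF) !mem_cat !negb_or /=.
    by case/and3P: xL => _ -> ->; case/and3P: yL => _ -> ->.
  have xxg v : v != v + g by rewrite -{1}[v]addr0 (inj_eq (addrI v)) eq_sym.
  have xyg : x != y + g by apply: contraNneq yg => ->; rewrite cubeDK.
  by rewrite !inE !negb_or nxy !xxg xyg [x + g == y]eq_sym yg (inj_eq (addIr g)) nxy.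
have L_i v : v \in L -> v i = x i.
  have gi0 : g i = false by apply/negbTE.
  rewrite !mem_cat !inE; case/or3P=> [vU|vW|/or4P[]/eqP->].
  - by apply: iL; rewrite !mem_cat vU orbT.
  - by apply: iL; rewrite !mem_cat vW !orbT.
  - by [].
  - by rewrite cubeDE gi0 addbF.
  - by [].
  - by rewrite cubeDE gi0 addbF.
(* The landing points in the half of [z], at most 2 (2k - 4) + 4 = 4k - 4 as the fan requires. If
   [z] is one of them, it is left out, and the corresponding [r v] below is empty: that crossing
   ends at [z] directly. *)
pose M : {set V} := [set v + d | v : V in L] :\ z.
have leM : (#|M| <= 2 * n - 4)%N.
  apply: leq_trans (subset_leq_card (subD1set _ _)) _.
  apply: leq_trans (leq_imset_card _ _) _; apply: leq_trans (card_size _) _.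
  by rewrite /L !size_cat szU szW n4 /=; clear -k2; lia.
have zM : z \notin M by rewrite !inE eqxx.
have M_i u : u \in M -> u i = z i.
  rewrite in_setD1 => /andP[_ /imsetP[v vL ->]].
  by rewrite cubeDE (L_i v vL) di addbT; case: (z i) (x i) zx => -[].
have [q [pq lq Dq] uq] := fan i_gt0 i_lt leM zM M_i.
pose r v := if v + d == z then [::] else (v + d) :: q (v + d).
have LM v : v \in L -> v + d != z -> v + d \in M.
  by move=> vL nz; rewrite in_setD1 nz; apply: imset_f.
have r_path v w : v \in L -> cube w (v + d) -> path cube w (rcons (r v) z).
  move=> vL; rewrite /r; case: eqVneq => [->|nz] wv; first by rewrite /= wv.
  have vM := LM v vL nz; rewrite rcons_path /= wv; apply/andP; split.
    have := pq _ vM; rewrite path_avoiding => /andP[+ _].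
    by apply: sub_path => a b; apply: half_cube.
  by have := lq _ vM; rewrite inE cube_sym => /half_cube.
have r_z v w : v \in L -> w \in r v -> w != z /\ w i = z i.
  rewrite /r; case: eqVneq => // nz vL wr; have vM := LM v vL nz.
  have := pq _ vM; rewrite path_avoiding => /andP[hq aq].
  split; last by rewrite (path_halfE hq wr) M_i.
  move: wr; rewrite inE => /predU1P[->//|/(allP aq)].
  by rewrite /= inE.
have r_disj v v' w : v \in L -> v' \in L -> w \in r v -> w \in r v' -> v = v'.
  rewrite /r; case: eqVneq => // nz; case: eqVneq => // nz' vL vL' wr wr'.
  by apply: (addIr d); apply: (Dq _ _ w); rewrite ?LM.
have r_uniq v : v \in L -> uniq (r v).
  by rewrite /r; case: eqVneq => // nz vL; apply: uq; apply: LM.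
have r_nil v v' : r v = [::] -> r v' = [::] -> v = v'.
  by rewrite /r; case: eqVneq => // <- _; case: eqVneq => // /addIr.
have UL v : v \in U -> v \in L by rewrite mem_cat => ->.
have WL v : v \in W -> v \in L by rewrite !mem_cat => ->; rewrite orbT.
have [xL xgL yL ygL] : [/\ x \in L, x + g \in L, y \in L & y + g \in L].
  by rewrite !mem_cat !inE !eqxx !orbT.
have xxd v : cube v (v + d) by rewrite /cube /= cubeKD.
have xxgd v : cube v (v + g + d) by rewrite /cube /= -addrA cubeKD.
have legs v (S : seq V) : (forall u, u \in S -> cube v u) -> (forall u, u \in S -> u \in L) ->
    v \in L -> v + g \in L ->
    forall s, s \in [seq u :: r u | u <- S] ++ [:: r v; r (v + g)] -> path cube v (rcons s z).
  move=> vS SL vL vgL s; rewrite mem_cat !inE => /or3P[/mapP[u uS ->]|/eqP->|/eqP->].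
  - by rewrite /= vS // r_path ?SL.
  - exact: r_path.
  - exact: r_path.
have legs_nil v (S : seq V) :
    (count (@nilp V) ([seq u :: r u | u <- S] ++ [:: r v; r (v + g)%R]) <= 1)%N.
  rewrite count_cat; have -> : count (@nilp V) [seq u :: r u | u <- S] = 0%N.
    by apply/eqP; rewrite -leqn0 leqNgt -has_count; apply/hasPn=> _ /mapP[a _ ->].
  rewrite add0n /= addn0; case: (r v) (r_nil v (v + g)) => [|? ?]; case: (r (v + g)) => [|? ?] //.
  move/(_ erefl erefl)/eqP; rewrite -{1}[v]addr0 (inj_eq (addrI v)) eq_sym.
  by rewrite (negbTE gn0).
exists F, ([seq u :: r u | u <- W] ++ [:: r y; r (y + g)]),
  ([seq u :: r u | u <- U] ++ [:: r x; r (x + g)]).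
split; [split | split; [| split]].
- move=> f /pF; apply: sub_path => a b; exact: half_cube.
- by apply: legs => // u /pW/half_cube.
- by apply: legs => // u /pU/half_cube.
- rewrite !size_cat !size_map szF szU szW /=; clear -k2; split; lia.
- by split.
(* [s0] lies in the half of [x] and [s1] in that of [z], so uniqueness can be checked in each half
   separately. *)
pose s0 := x :: y :: flatten F ++ U ++ W; pose s1 := z :: flatten [seq r v | v <- L].
have perm_s : perm_eq (x :: y :: z :: flatten (F ++ ([seq u :: r u | u <- W] ++ [:: r y; r (y + g)]) ++
    ([seq u :: r u | u <- U] ++ [:: r x; r (x + g)]))) (s0 ++ s1).
  apply/permP=> P; rewrite /s0 /s1 /L !map_cat !flatten_cat /= !count_cat /= !count_cat.
  have /permP -> := perm_flatten_cons r U; have /permP -> := perm_flatten_cons r W.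
  by rewrite !count_cat /=; clear; lia.
rewrite (perm_uniq perm_s) cat_uniq; apply/and3P; split=> //.
  apply/hasPn=> w ws1; have wz : w i = z i.
    move: ws1; rewrite inE => /predU1P[->//|/flatten_mapP[v vL wr]].
    by case: (r_z v w vL wr).
  apply/negP=> ws0; have : w i = x i.
    move: ws0; rewrite 2!inE => /or3P[/eqP->|/eqP->|/iL] //.
  by move=> wx; rewrite -wz wx eqxx in zx.
apply/andP; split.
  apply/negP=> /flatten_mapP[v vL zr]; have [zz _] := r_z v z vL zr.
  by rewrite eqxx in zz.
apply: flatten_map_uniq => // v v' w; exact: r_disj.
Qed.

End Segments.

(** * Augmented cubes as Cayley graphs *)

(** After the common prefix, of length [j], a hypercubic edge changes one bit ([c] true) and a
    complementary edge changes the whole remaining suffix ([c] false). *)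
Lemma aq_adjP (s t : seq bool) : size s = size t ->
  reflect (exists j c, (j < size s)%N /\ forall k, (k < size s)%N ->
     nth false s k (+) nth false t k = if c then k == j else (j <= k)%N)
  (aq_adj s t).
Proof.
elim: s t => [|a s IH] [|b t] //=; first by move=> _; constructor=> -[j [c []]].
case=> eqst; have [->|neq] := eqVneq a b.
  apply: (iffP (IH t eqst)) => -[j [c [ltj zP]]].
    exists j.+1, c; split=> // -[|k] ltk /=; last by rewrite zP //; case: c.
    by rewrite addbb; case: c {zP}.
  case: j ltj zP => [|j] ltj zP; first by have := zP 0 isT; rewrite /= addbb; case: c {zP}.
  by exists j, c; split=> // k ltk; have := zP k.+1 ltk; case: c {zP}.
apply: (iffP orP) => [[]/eqP->|[j [c [_ zP]]]].
- exists 0, true; split=> // -[_|k _] /=; last by rewrite addbb.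
  by move: neq; case: (a) (b) => -[].
- exists 0, false; split=> // -[_|k ltk] /=; first by move: neq; case: (a) (b) => -[].
  by rewrite (nth_map false) ?addbN ?addbb.
have j0 : j = 0.
  have := zP 0 isT; rewrite /=; have -> : a (+) b by move: neq; case: (a) (b) => -[].
  by case: c {zP} => /esym; [move/eqP | rewrite leqn0 => /eqP].
have {}zP k : (k < size s)%N -> nth false s k (+) nth false t k = ~~ c.
  by move=> ltk; have := zP k.+1 ltk; rewrite j0 /= => ->; case: c {zP}.
case: c zP => zP; [left | right]; apply/eqP; apply: (@eq_from_nth _ false);
  rewrite ?size_map -?eqst // => k ltk.
  by have := zP k ltk; case: (nth _ s k) (nth _ t k) => -[].
by rewrite (nth_map false) //; have := zP k ltk; case: (nth _ s k) (nth _ t k) => -[].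
Qed.

Section Transport.
Local Open Scope ring_scope.
Variable n : nat.
Local Notation V := {ffun 'I_n -> bool}.
Local Notation T := (n.-tuple bool).

(* In the basis of suffixes 0..01..1 the hypercubic edges become sums of two
   consecutive basis vectors and the complementary edges become basis vectors. *)
Definition coords (x : T) : V := [ffun t : 'I_n => nth false x t (+) nth false (false :: x) t].

Definition bitdiff (x y : T) k := nth false x k (+) nth false y k.

Lemma coordsD x y (t : 'I_n) :
  (coords x + coords y) t = bitdiff x y t (+) (if t : nat is k.+1 then bitdiff x y k else false).
Proof.
rewrite cubeDE !ffunE /bitdiff; case: (nat_of_ord t) => [|k] /=; first by rewrite !addbF.
exact: addbACA.
Qed.

(** Coordinates are sums of two neighbouring bits, so the bits are recovered from the front by
    induction. *)
Lemma bitdiff_coords (f : nat -> bool) x y :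
  (forall t : 'I_n, (coords x + coords y) t = f t (+) (if t : nat is k.+1 then f k else false)) ->
  forall k, (k < n)%N -> bitdiff x y k = f k.
Proof.
move=> fP; elim=> [|k IH] ltk; have := fP (Ordinal ltk); rewrite coordsD /=.
  by rewrite !addbF.
by rewrite IH ?(ltnW ltk) // => /addIb.
Qed.

Lemma coords_inj : injective coords.
Proof.
move=> x y eqxy; apply: eq_from_tnth => t; rewrite !(tnth_nth false).
have eq0 : bitdiff x y t = false.
  apply: (@bitdiff_coords (fun=> false)) => // u.
  by rewrite eqxy cubeDD ffunE; case: (nat_of_ord u).
by move: eq0; rewrite /bitdiff; case: (nth _ x t) (nth _ y t) => -[].
Qed.

Lemma AQ_coords (x y : T) : AQ x y = cube (coords x) (coords y).
Proof.
have sz : size x = size y by rewrite !size_tuple.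
apply/(aq_adjP sz)/imsetP => [[j [c [ltj zP]]]|[[c j] _ /= eqg]].
  rewrite size_tuple in ltj zP.
  exists (c, Ordinal ltj) => //; apply/ffunP=> t; rewrite coordsD ffunE /=.
  rewrite /bitdiff zP //; case: t => -[|k] ltk /=.
    by case: c {zP}; rewrite ?orbF; lia.
  by rewrite zP ?(ltnW ltk) //; case: c {zP}; lia.
exists j, c; rewrite size_tuple; split=> // k ltk.
apply: (@bitdiff_coords (fun k => if c then k == j else (j <= k)%N)) => // t.
rewrite eqg ffunE; case: (nat_of_ord t) => [|m]; case: c {eqg} => /=; lia.
Qed.

Lemma coords_bij : bijective coords.
Proof. by apply: (inj_card_bij coords_inj); rewrite card_ffun card_tuple card_ord. Qed.

Definition flip (o : 'I_n) (v : V) : V := v + (if v o then gen n false o.+1 else 0).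

Lemma flip_o o v : flip o v o = v o.
Proof. by rewrite /flip cubeDE; case: (v o); rewrite ffunE ?addbF //= orbF; lia. Qed.

Lemma flipK o : involutive (flip o).
Proof. by move=> v; rewrite {1}/flip flip_o /flip; case: (v o); rewrite ?addr0 // cubeDK. Qed.

Lemma flipD o u v : flip o u + flip o v = flip o (u + v).
Proof.
rewrite /flip cubeDE addrACA; congr (_ + _).
by case: (u o) (v o) => -[] /=; rewrite ?addr0 ?add0r ?cubeDD.
Qed.

(** Only d_0 and d_0 + d_1 involve coordinate 0. The shear exchanges these two and fixes every other
    generator. *)
Lemma flip_gens (o : 'I_n) v : o = 0 :> nat -> (1 < n)%N -> v \in gens n -> flip o v \in gens n.
Proof.
move=> o0 n1 /imsetP[[b j] _ /= ->]; rewrite /flip ffunE o0 /= andbF orbF.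
case: eqP => [j0|_]; last by rewrite addr0 gen_in.
suff -> : gen n b j + gen n false 1 = gen n (~~ b) 0 by rewrite gen_in // ltnW.
by apply/ffunP=> t; rewrite cubeDE !ffunE -j0 /=; case: b; rewrite /= ?orbF; lia.
Qed.

Lemma cube_path_AQ (f : T -> V) (h : V -> T) : cancel h f ->
  (forall x y, cube (f x) (f y) -> AQ x y) ->
  forall x s y, path (@cube n) (f x) (rcons s (f y)) -> path (@AQ n) x (rcons [seq h v | v <- s] y).
Proof.
move=> hK fAQ x s y; elim: s x => [|v s IH] x /=; first by rewrite !andbT => /fAQ.
case/andP=> xv vs; apply/andP; split; first by apply: fAQ; rewrite hK.
by apply: IH; rewrite hK.
Qed.

Lemma pi_set_split (f : T -> V) (x y z : T) (i : 'I_n) k : bijective f ->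
  (forall x y, cube (f x) (f y) -> AQ x y) -> n = (2 * k)%N -> (2 <= k)%N ->
  (0 < i)%N -> (i.+1 < n)%N -> x != y -> f x i = f y i -> f z i != f x i ->
  (k + k + (k - 2) <= pi_set (@AQ n) [set x; y; z])%N.
Proof.
case=> h fK hK fAQ n2k k2 i0 i1 nxy xy xz.
have nfxy : f x != f y by rewrite (can_eq fK).
have [Sxy [Syz [Sxz [[pxy pyz pxz] [[sxy syz sxz] [[nxy1 nyz1 nxz1] uS]]]]]] :=
  cube_segments i0 i1 n2k k2 nfxy xy xz.
pose m := map (map h); have hP := cube_path_AQ hK fAQ.
have count_m (S : seq (seq V)) : count (@nilp _) (m S) = count (@nilp _) S.
  by rewrite count_map; apply: eq_count => -[].
apply: (@pi_set_segments _ _ x y z k k (k - 2) (m Sxy) (m Syz) (m Sxz));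
  rewrite ?count_m ?size_map //; first exact: AQ_symmetric.
- by move=> _ /mapP[s /pxy/hP ? ->].
- by move=> _ /mapP[s /pyz/hP ? ->].
- by move=> _ /mapP[s /pxz/hP ? ->].
rewrite -!map_cat -map_flatten -[x]fK -[y]fK -[z]fK -!map_cons map_inj_uniq //.
exact: can_inj hK.
Qed.

Lemma pi_set_geq (D : {set T}) k : n = (2 * k)%N -> (2 <= k)%N -> #|D| = 3%N ->
  (3 * k - 2 <= pi_set (@AQ n) D)%N.
Proof.
move=> n2k k2 D3; have -> : (3 * k - 2 = k + k + (k - 2))%N by clear -k2; lia.
have [x [y [z [nxy nxz nyz ->]]]] : exists x y z, [/\ x != y, x != z, y != z & D = [set x; y; z]].
  move: (D3); rewrite cardE; have := enum_uniq D.
  have eD v : (v \in D) = (v \in enum D) by rewrite mem_enum.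
  case: (enum D) eD => [|x [|y [|z []]]] //= eD; rewrite !inE !negb_or !andbT.
  case/andP=> /andP[nxy nxz] nyz _; exists x, y, z; split=> //; apply/setP=> v.
  by rewrite eD !inE orbA.
have n1 : (1 < n)%N by clear -n2k k2; lia.
have some_split (f : T -> V) (i : 'I_n) : bijective f -> (forall x y, cube (f x) (f y) -> AQ x y) ->
    (0 < i)%N -> (i.+1 < n)%N -> ~~ [&& f x i == f y i & f x i == f z i] ->
    (k + k + (k - 2) <= pi_set (@AQ n) [set x; y; z])%N.
  move=> bf fAQ i0 i1; have [xy|nfxy] := eqVneq (f x i) (f y i).
    by rewrite eq_sym /= => xz; apply: (pi_set_split (f := f) (i := i)).
  move=> _; have [xz|nfxz] := eqVneq (f x i) (f z i).
    have -> : [set x; y; z] = [set x; z; y] by rewrite -!setUA [[set y] :|: _]setUC.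
    by apply: (pi_set_split (f := f) (i := i)); rewrite // eq_sym.
  have -> : [set x; y; z] = [set y; z; x] by apply/setP=> v; rewrite !inE -orbA orbC.
  apply: (pi_set_split (f := f) (i := i)) => //.
  by case: (f x i) (f y i) (f z i) nfxy nfxz => -[] [].
have cAQ u v : cube (coords u) (coords v) -> AQ u v by rewrite AQ_coords.
pose agree i := (coords x i == coords y i) && (coords x i == coords z i).
have [/existsP[i /and3P[i0 i1 nai]]|/existsPn all_agree] :=
  boolP [exists i : 'I_n, [&& (0 < i)%N, (i.+1 < n)%N & ~~ agree i]].
  exact: (some_split coords i coords_bij cAQ i0 i1 nai).
pose o0 : 'I_n := Ordinal (ltnW n1); pose o1 : 'I_n := Ordinal n1.
have mid (i : 'I_n) : (0 < i)%N -> (i.+1 < n)%N -> agree i.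
  by move=> i0 i1; have := all_agree i; rewrite i0 i1 /= negbK.
(* If the triple disagrees at coordinate 0 while it agrees at coordinate 1, the shear adds
   coordinate 0 to coordinate 1 and so creates a disagreement at an interior coordinate. *)
have [a0|na0] := boolP (agree o0); last first.
  pose f u := flip o0 (coords u).
  apply: (some_split f o1) => //.
  - exact: bij_comp (inv_bij (@flipK o0)) coords_bij.
  - move=> u v; rewrite /cube /= /f flipD => uv; apply: cAQ; rewrite /cube /=.
    by rewrite -(flipK o0 (_ + _)) flip_gens.
  - by rewrite /=; clear -n2k k2; lia.
  - have /andP[/eqP e1 /eqP e2] : agree o1 by apply: mid; rewrite //=; clear -n2k k2; lia.
    have fE u : f u o1 = coords u o1 (+) coords u o0.
      by rewrite /f /flip cubeDE; congr addb; case: (coords u o0); rewrite ffunE.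
    by rewrite !fE -e1 -e2 !(inj_eq (@addbI _)).
(* What remains is agreement everywhere but at the last coordinate, and one bit cannot distinguish
   three vertices. *)
have ltl : (n.-1 < n)%N by clear -n1; lia.
have alast (t : 'I_n) : t != Ordinal ltl -> agree t.
  rewrite -val_eqE /= => nt; have [t0|t0] := posnP t.
    have -> : t = o0 by apply: val_inj; rewrite /= t0.
    exact: a0.
  by apply: mid => //; move: nt (ltn_ord t); clear; lia.
have ne u v : u != v -> (forall t, t != Ordinal ltl -> coords u t = coords v t) ->
    coords u (Ordinal ltl) != coords v (Ordinal ltl).
  move=> nuv uv; apply: contra nuv => /eqP eql; apply/eqP/coords_inj/ffunP=> t.
  by have [->|/uv] := eqVneq t (Ordinal ltl).
have := ne x y nxy (fun t nt => eqP (proj1 (andP (alast t nt)))).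
have := ne x z nxz (fun t nt => eqP (proj2 (andP (alast t nt)))).
have := ne y z nyz; have H t : t != Ordinal ltl -> coords y t = coords z t.
  by move/alast/andP=> [/eqP <- /eqP].
by move/(_ H); case: (coords x _) (coords y _) (coords z _) => -[] [].
Qed.

Lemma card_AQ_nbr (u : T) : (0 < n)%N -> (#|[set v | AQ u v]| <= (2 * n).-1)%N.
Proof.
move=> n0; rewrite -(card_gens n0).
rewrite -(card_imset (f := fun v : T => coords u + coords v)); last first.
  by move=> v w /addrI/coords_inj.
apply: subset_leq_card; apply/subsetP=> _ /imsetP[v + ->].
by rewrite inE AQ_coords.
Qed.

(** In coordinates the triple is d_0, d_0 + d_1, d_2, all adjacent to 0. They are adjacent to d_1 as
    well, because adding d_1 gives d_0 + d_1, d_0 and d_1 + d_2. *)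
Lemma pi_set_witness k : n = (2 * k)%N -> (2 <= k)%N ->
  exists2 D : {set T}, #|D| = 3%N & (pi_set (@AQ n) D <= 3 * k - 2)%N.
Proof.
move=> n2k k2; have n3 : (3 < n)%N by clear -n2k k2; lia.
case: coords_bij => h hK coordsK; have h_inj := can_inj coordsK.
have [n0 n1 n2] : [/\ (0 < n)%N, (1 < n)%N & (2 < n)%N] by clear -n3; split; lia.
have gneq (u v : V) j (ltj : (j < n)%N) : u (Ordinal ltj) != v (Ordinal ltj) -> h u != h v.
  by move=> nuv; rewrite (inj_eq h_inj); apply: contraNneq nuv => ->.
pose a := gen n false 0; pose b := gen n true 0; pose c := gen n false 2.
pose v2 := gen n false 1.
have hab : h a != h b by rewrite (gneq a b 1 n1) // !ffunE.
have hac : h a != h c by rewrite (gneq a c 0 n0) // !ffunE.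
have hbc : h b != h c by rewrite (gneq b c 0 n0) // !ffunE.
have D3 : #|[set h a; h b; h c]| = 3%N.
  by rewrite setUC cardsU1 cards2 !inE negb_or ![h c == _]eq_sym hab hac hbc.
exists [set h a; h b; h c] => //.
apply: leq_trans (_ : (3 * (2 * n).-1 - 2) %/ 4 <= _)%N; last first.
  (* Both wasted arcs count: with only one, the numerator would be 4 (3k - 1) and the bound 3k -
     1. *)
  have -> : ((3 * (2 * n).-1 - 2) = 4 * (3 * k - 2) + 3)%N by clear -n2k k2; lia.
  by rewrite [(4 * _)%N]mulnC divnMDl // divn_small ?addn0.
apply: (pi_set_leq (v1 := h 0) (v2 := h v2)).
- exact: AQ_symmetric.
- by [].
- by move=> u _; apply: card_AQ_nbr.
- by rewrite (gneq 0 v2 1 n1) // !ffunE.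
- by rewrite !inE !negb_or (gneq 0 a 0 n0) ?(gneq 0 b 0 n0) ?(gneq 0 c 2 n2) // !ffunE.
- by rewrite !inE !negb_or (gneq v2 a 0 n0) ?(gneq v2 b 0 n0) ?(gneq v2 c 2 n2) // !ffunE.
have av2 : a + v2 = b by apply/ffunP=> t; rewrite cubeDE !ffunE; clear; rewrite /= ?orbF; lia.
have bv2 : b + v2 = a by rewrite -av2 cubeDK.
have cv2 : c + v2 = gen n true 1.
  by apply/ffunP=> t; rewrite cubeDE !ffunE; clear; rewrite /= ?orbF; lia.
move=> u; rewrite !inE => /orP[/orP[]|] /eqP->;
  by rewrite !AQ_coords !coordsK /cube /= addr0 ?av2 ?bv2 ?cv2 !gen_in.
Qed.

End Transport.

Theorem theorem1 (n : nat) (hn : 4 <= n) (hev : ~~ odd n) :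
  path_connectivity (@AQ n) 3 = (3 * n) %/ 2 - 2.
Proof.
have n2k : n = 2 * n./2 by rewrite mul2n even_halfK.
have k2 : 2 <= n./2 by clear hev; lia.
have -> : (3 * n) %/ 2 - 2 = 3 * n./2 - 2.
  by rewrite {1}n2k mulnCA mulKn.
apply/eqP; rewrite eqn_leq; apply/andP; split.
  have [D D3 leD] := pi_set_witness n2k k2.
  by apply: leq_trans leD; rewrite -D3 path_connectivity_le.
have le3 : 3 <= #|{: n.-tuple bool}|.
  rewrite card_tuple card_bool; apply: (@leq_trans (2 ^ 2)) => //.
  by rewrite leq_exp2l // ltnW // ltnW.
have [D D3 <-] := path_connectivity_attained (@AQ n) le3.
exact: pi_set_geq.
Qed.
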